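(* Let $(X,Y)$ be a dual pair of Calabi--Yau threefolds, $X=Z(p_*s)\subset G(2,V_5)$, $Y=Z(q_*s)\subset G(3,V_5)$ with $s\in H^0(F,\mathcal O(1,1))$. Let $G=GL(3,\mathbb C)$ act on $\mathcal V=\operatorname{Hom}(\mathbb C^3,V_5)\times(\mathbb C^3)^\vee$ by $g\cdot(B,\omega)=(Bg^{-1},\det(g)^2\,\omega g^{-1})$, let $\hat s:\operatorname{Hom}(\mathbb C^3,V_5)\to\mathbb C^3$ be the $G$-equivariant polynomial map corresponding to $q_*s$, let $\check s:\mathcal V\to\mathbb C$, $\check s(B,\omega)=\omega\cdot\hat s(B)$, be the associated $G$-invariant superpotential, and let $\rho_\tau$ be the character $\rho_\tau(g)=\det(g)^{-\tau}$. Then the gauged linear sigma model $(\mathcal V,G,\check s)$ has two Calabi--Yau phases, with vacuum manifolds $\mathcal M_{\rho_\tau}=\operatorname{Crit}(\check s)/\!/_{\rho_\tau}G$ as follows: for $\tau>0$, $\mathcal M_{\rho_\tau}$ is isomorphic to $Y$; for $\tau<0$, $\mathcal M_{\rho_\tau}$ is isomorphic to $X$.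
   Context: The base field is $\mathbb C$ and $V_5$ is a five-dimensional vector space. $G(k,V_5)$ is the Grassmannian of $k$-dimensional subspaces of $V_5$, with universal bundle $\mathcal U_k$ and universal quotient bundle $\mathcal Q_k$; $\mathcal O(1)$ is the Plücker hyperplane bundle. $F=\{([V],[W])\in G(2,V_5)\times G(3,V_5): V\subset W\}$ has projections $p:F\to G(2,V_5)$, $q:F\to G(3,V_5)$, and $\mathcal O(1,1)=p^*\mathcal O(1)\otimes q^*\mathcal O(1)$. One has $p_*\mathcal O(1,1)=\mathcal Q_2^\vee(2)$ and $q_*\mathcal O(1,1)=\mathcal U_3(2)$; $p_*s$ and $q_*s$ denote the sections of these bundles corresponding to $s$. Two Calabi--Yau threefolds $X\subset G(2,V_5)$ and $Y\subset G(3,V_5)$ are dual if $X=Z(p_*s)$ and $Y=Z(q_*s)$ for some $s\in H^0(F,\mathcal O(1,1))$, $Z(\cdot)$ denoting the zero locus. Writing $G(3,V_5)=(\operatorname{Hom}(\mathbb C^3,V_5)\setminus\{\operatorname{rk}<3\})/GL(3,\mathbb C)$ with $B\sim Bg^{-1}$, the bundle $\mathcal U_3(2)$ is the quotient of $(\operatorname{Hom}(\mathbb C^3,V_5)\setminus\{\operatorname{rk}<3\})\times\mathbb C^3$ by $(B,v)\sim(Bg^{-1},\det(g)^{-2}gv)$. A section of $\mathcal U_3(2)$ thus corresponds to a map $\hat s$ on matrices of rank $3$ with $\hat s(Bg^{-1})=\det(g)^{-2}g\,\hat s(B)$ (the section being $[B]\mapsto[B,\hat s(B)]$), which extends uniquely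 to a polynomial map on all of $\operatorname{Hom}(\mathbb C^3,V_5)$. A gauged linear sigma model is a vector space $\mathcal V$ with an action of a reductive group $G$ and a $G$-invariant function $w:\mathcal V\to\mathbb C$ (the superpotential); $\operatorname{Crit}(w)=Z(dw)$. For a character $\rho:G\to\mathbb C^*$ the semistable locus is $\mathcal V^{ss}_\rho=\{v\in\mathcal V:\overline{\{(\rho(g)^{-1},gv):g\in G\}}\cap(\{0\}\times\mathcal V)=\emptyset\}$, and the vacuum manifold $\mathcal M_\rho=\operatorname{Crit}(w)/\!/_\rho G$ is the GIT quotient of $\operatorname{Crit}(w)$ with respect to this notion of semistability. Phases correspond to chambers of characters giving the same GIT quotient. *)

(* Defs.v *)
(* MathComp and multinomials; the base field is R[i], for R : realType. *)
From HB Require Import structures.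
From mathcomp Require Import all_boot all_order all_algebra.
From mathcomp Require Import classical_sets reals.
From mathcomp Require Import complex mpoly.
Set Implicit Arguments.
Unset Strict Implicit.
Unset Printing Implicit Defensive.
Import Order.TTheory GRing.Theory Num.Theory.
Local Open Scope classical_set_scope.
Local Open Scope ring_scope.

Section Spaces.
Variable R : realType.
Local Notation C := R[i].

(* The coordinates are taken in some fixed basis; none of the notions below
   depends on which one. *)
Definition peval (vT : vectType C) (p : {mpoly C[\dim {:vT}]}) (v : vT) : C :=
  p.@[fun i => coord (vbasis {:vT}) i v].

Definition zclosure (vT : vectType C) (A : set vT) : set vT :=
  [set x | forall p : {mpoly C[\dim {:vT}]},
     (forall y, A y -> peval p y = 0) -> peval p x = 0].

(* A topological space with a sheaf of C-valued functions. A function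
   on an open set U is represented by a total function whose values outside U
   are irrelevant. The sheaf axioms are not recorded: they hold for all
   the spaces constructed below. *)
Record space := Space {
  point :> Type;
  isopen : set point -> Prop;
  regular : set point -> (point -> C) -> Prop
}.

Definition affine (vT : vectType C) : space := {|
  point := vT;
  isopen := fun U => forall x, U x -> exists2 p : {mpoly C[\dim {:vT}]},
    peval p x != 0 & forall y, peval p y != 0 -> U y;
  regular := fun U f => forall x, U x -> exists p q : {mpoly C[\dim {:vT}]},
    peval q x != 0 /\
    forall y, U y -> peval q y != 0 -> f y = peval p y / peval q y
|}.

(* Subset with the induced topology; functions are local restrictions of
   regular functions of the ambient space. On a locally closed subset
   of a variety this is the structure of reduced subvariety. *)
Definition subspace (X : space) (A : set X) : space := {|
  point := {x : X | A x};
  isopen := fun U => exists2 V : set X, isopen V & U = @sval X A @^-1` V;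
  regular := fun U f => forall x, U x -> exists (V : set X) (h : X -> C),
    [/\ isopen V, V (sval x), regular V h &
        forall y, V (sval y) -> U y /\ f y = h (sval y)]
|}.

(* Set of classes, with the quotient topology and the functions whose
   pull-back is regular. *)
Definition eqclass (X : space) (E : X -> X -> Prop) (x : X) :
    {c : set X | exists x, c = E x} :=
  exist _ (E x) (ex_intro _ x erefl).

Definition quotient (X : space) (E : X -> X -> Prop) : space := {|
  point := {c : set X | exists x, c = E x};
  isopen := fun U => isopen (eqclass E @^-1` U);
  regular := fun U f => regular (eqclass E @^-1` U) (f \o eqclass E)
|}.

Definition morphism (X Y : space) (f : X -> Y) : Prop :=
  forall V : set Y, isopen V -> isopen (f @^-1` V) /\
    forall h, regular V h -> regular (f @^-1` V) (h \o f).

Definition isomorphic (X Y : space) : Prop :=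
  exists (f : X -> Y) (g : Y -> X),
    [/\ morphism f, morphism g, cancel f g & cancel g f].

Definition projective_space (n : nat) : space :=
  quotient (fun x y : subspace (X := affine 'rV[C]_n.+1) [set v | v != 0] =>
    exists2 a : C, a != 0 & sval y = a *: sval x).

Definition projective (X : space) : Prop :=
  exists n (A : set (projective_space n)),
    isopen (~` A) /\ isomorphic X (subspace A).

Definition irreducible (X : space) : Prop :=
  [set: X] !=set0 /\
  forall U V : set X, isopen U -> isopen V -> U !=set0 -> V !=set0 ->
    U `&` V !=set0.

Definition germ (X : space) (x : X) (f : X -> C) : Prop :=
  exists U : set X, [/\ isopen U, U x & regular U f].

(* Derivations of the local ring at x; the values of D on functions that are
   not regular near x are irrelevant. *)
Definition derivation (X : space) (x : X) (D : (X -> C) -> C) : Prop :=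
  forall f g, germ x f -> germ x g ->
    [/\ (exists U : set X, [/\ isopen U, U x & forall y, U y -> f y = g y]) ->
          D f = D g,
        forall a, D (fun y => a * f y + g y) = a * D f + D g &
        D (fun y => f y * g y) = f x * D g + g x * D f].

Definition tangent_dim (X : space) (x : X) (d : nat) : Prop :=
  exists D : 'I_d -> (X -> C) -> C,
    (forall i, derivation x (D i)) /\
    forall E, derivation x E -> exists! c : 'rV[C]_d,
      forall f, germ x f -> E f = \sum_i c 0 i * D i f.

(* A nowhere vanishing regular 3-form: alpha is locally h dt_1 dt_2 dt_3, and
   is nonzero on the tangent space at every point. On a smooth threefold
   every regular 3-form is locally of this shape. *)
Definition trivial_canonical3 (X : space) : Prop :=
  exists alpha : forall x : X, ('I_3 -> (X -> C) -> C) -> C,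
    (forall x, exists (U : set X) (h : X -> C) (t : 'I_3 -> X -> C),
       [/\ isopen U, U x, regular U h, forall j, regular U (t j) &
           forall y D, U y -> (forall i, derivation y (D i)) ->
             alpha y D = h y * \det (\matrix_(i, j) D i (t j))]) /\
    (forall x, exists2 D,
       forall i, derivation x (D i) & alpha x D != 0).

(* H^1(X, O) is the direct limit of the Cech H^1 of the open covers of X, each
   of which injects into it; so it vanishes exactly when, for every cover, all
   Cech 1-cocycles are coboundaries. *)
Definition H1O_zero (X : space) : Prop :=
  forall (I : Type) (U : I -> set X) (f : I -> I -> X -> C),
    (forall i, isopen (U i)) -> (forall x, exists i, U i x) ->
    (forall i j, regular (U i `&` U j) (f i j)) ->
    (forall i j k x, U i x -> U j x -> U k x ->
       f i j x + f j k x = f i k x) ->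
  exists g : I -> X -> C,
    (forall i, regular (U i) (g i)) /\
    forall i j x, U i x -> U j x -> f i j x = g j x - g i x.

(* Smooth projective threefold with trivial canonical bundle and
   h^1(O) = 0; then h^2(O) = 0 by Serre duality. An irreducible variety all
   of whose Zariski tangent spaces have dimension d is smooth of
   dimension d. *)
Definition calabi_yau3 (X : space) : Prop :=
  [/\ projective X, irreducible X, forall x : X, tangent_dim x 3,
      trivial_canonical3 X & H1O_zero X].

End Spaces.

Section Grassmannians.
Variable R : realType.
Local Notation C := R[i].

Definition frames (k : nat) : space R :=
  subspace (X := affine 'M[C]_(5, k)) [set B : 'M[C]_(5, k) | \rank B == k].

(* The point of G(k, V_5) given by a k-dimensional subspace is the set of its
   bases, seen as injective maps C^k -> V_5. *)
Definition Gr (k : nat) : space R :=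
  quotient (fun A B : frames k =>
    exists2 g : 'M[C]_k, g \in unitmx & sval B = sval A *m invmx g).

(* A section of a homogeneous bundle on G(k, V_5) with fibre in C^m is given by
   an equivariant map sigma on the matrices of rank k. *)
Definition zero_locus (k m : nat) (sigma : 'M[C]_(5, k) -> 'cV[C]_m) : space R :=
  subspace (X := Gr k) [set c | forall A, sval c A -> sigma (sval A) = 0].

Definition poly_extension (k m : nat) (sigma : 'M[C]_(5, k) -> 'cV[C]_m)
    (p : 'I_m -> {mpoly C[\dim {:'M[C]_(5, k)}]}) : Prop :=
  forall A, \rank A == k -> forall i, sigma A i 0 = peval (p i) A.

(* The zero scheme of sigma is smooth of codimension 3: at each
   zero the differential of sigma has rank 3. As sigma vanishes along the orbit
   of a zero A under GL(k), its differential at A is defined on the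
   tangent space of G(k, V_5). *)
Definition smooth_zero_scheme (k m : nat)
    (sigma : 'M[C]_(5, k) -> 'cV[C]_m) : Prop :=
  exists2 p, poly_extension sigma p &
    forall A, \rank A == k -> sigma A = 0 ->
      \rank (\matrix_(i, j) peval (p i)^`M(j) A) = 3%N.

(* Z(sigma) is a Calabi--Yau threefold, as a scheme. The dimension 3 is that of
   G(2, V_5) and G(3, V_5), minus 3. *)
Definition calabi_yau3_zero_scheme (k m : nat)
    (sigma : 'M[C]_(5, k) -> 'cV[C]_m) : Prop :=
  smooth_zero_scheme sigma /\ calabi_yau3 (zero_locus sigma).

(* Pairs of bases of V and W, for V contained in W. *)
Definition flag_frames :
    set (affine ('M[C]_(5, 2) * 'M[C]_(5, 3))%type) :=
  [set x | [/\ \rank x.1 == 2%N, \rank x.2 == 3%N &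
               exists N : 'M[C]_(3, 2), x.1 = x.2 *m N]].

(* The fibre of O(1,1) at (V, W) is det V^* tensor det W^*, so a section is a
   regular function of bases A of V and B of W transforming by determinants.
   Only the values at pairs in flag_frames matter. *)
Definition section_O11 (s : 'M[C]_(5, 2) -> 'M[C]_(5, 3) -> C) : Prop :=
  regular (s := subspace flag_frames) setT
    (fun x => s (sval x).1 (sval x).2) /\
  forall A B h g, flag_frames (A, B) -> h \in unitmx -> g \in unitmx ->
    s (A *m invmx h) (B *m invmx g) = (\det h)^-1 * (\det g)^-1 * s A B.

(* p_* s as a section of Q_2^*(2): at the subspace V with basis A, the linear
   form w |-> s(A, (A | w)) on V_5 / V, here given by its values on the standard
   basis of V_5. The value is 0 when w lies in V; then (A | w) has rank 2. *)
Definition ppush (s : 'M[C]_(5, 2) -> 'M[C]_(5, 3) -> C)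
    (A : 'M[C]_(5, 2)) : 'cV[C]_5 :=
  \col_j let A' : 'M[C]_(5, 3) := row_mx A (delta_mx j 0 : 'cV_5) in
    if \rank A' == 3%N then s A A' else 0.

(* q_* s as a section of U_3(2): at the subspace W with basis B = (b_0, b_1, b_2),
   u /\ v |-> s((Bu | Bv), B) is a linear form on Lambda^2 C^3, hence is
   det(u, v, z) for a unique z, the value of the section. Its coordinate z_i is
   s((b_(i+1) | b_(i+2)), B), with indices mod 3. *)
Definition qpush (s : 'M[C]_(5, 2) -> 'M[C]_(5, 3) -> C)
    (B : 'M[C]_(5, 3)) : 'cV[C]_3 :=
  \col_i s (colsub (fun c : 'I_2 => inZp (i + c).+1) B) B.

End Grassmannians.

Section GLSM.
Variable R : realType.
Local Notation C := R[i].

Variables (n : nat) (vT : vectType C).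
Variable act : 'M[C]_n -> vT -> vT.

(* An algebraic linear action of GL(n) and an invariant polynomial. *)
Definition glsm (w : vT -> C) : Prop :=
  [/\ (forall v, act 1%:M v = v) /\
      (forall g h v, g \in unitmx -> h \in unitmx ->
         act (g *m h) v = act g (act h v)),
      forall g, g \in unitmx -> linear (act g),
      forall i, regular
        (s := subspace (X := affine ('M[C]_n * vT)%type)
                       [set x | x.1 \in unitmx]) setT
        (fun x => coord (vbasis {:vT}) i (act (sval x).1 (sval x).2)),
      exists p : {mpoly C[\dim {:vT}]}, w =1 peval p &
      forall g v, g \in unitmx -> w (act g v) = w v].

Definition crit (w : vT -> C) : set vT :=
  [set v | exists2 p : {mpoly C[\dim {:vT}]},
     w =1 peval p & forall i, peval p^`M(i) v = 0].

Definition semistable (rho : 'M[C]_n -> C) : set vT :=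
  [set v | forall u : vT,
     ~ zclosure [set x : C^o * vT |
          exists2 g, g \in unitmx & x = ((rho g)^-1, act g v)] (0, u)].

Definition orbit_of (v : vT) : set vT :=
  [set u | exists2 g, g \in unitmx & u = act g v].

(* GIT quotient of the semistable locus S = Z^ss of an affine closed
   subset Z: two points are identified when the closures of their orbits meet
   in S, and the functions are the invariant ones. This is the variety
   underlying Proj of the ring of semi-invariants. *)
Definition git_quotient (S : set vT) : space R :=
  quotient (fun x y : subspace (X := affine vT) S => exists2 z, S z &
    zclosure (orbit_of (sval x)) z /\ zclosure (orbit_of (sval y)) z).

Definition vacuum_manifold (w : vT -> C) (rho : 'M[C]_n -> C) : space R :=
  git_quotient (crit w `&` semistable rho).

(* Characters in the same chamber: the GIT quotients by G are formed from the
   same semistable locus. *)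
Definition same_phase (rho rho' : 'M[C]_n -> C) : Prop :=
  semistable rho = semistable rho'.

End GLSM.

Section Model.
Variable R : realType.
Local Notation C := R[i].

Definition model : vectType C := ('M[C]_(5, 3) * 'rV[C]_3)%type.

Definition model_act (g : 'M[C]_3) (x : model) : model :=
  (x.1 *m invmx g, \det g ^+ 2 *: (x.2 *m invmx g)).

Definition rho (tau : int) (g : 'M[C]_3) : C := \det g ^ (- tau).

Definition superpotential (shat : 'M[C]_(5, 3) -> 'cV[C]_3) (x : model) : C :=
  (x.2 *m shat x.1) 0 0.

End Model.

(* Main.v *)
Require Import Defs.
From HB Require Import structures.
From mathcomp Require Import all_boot all_order all_algebra.
From mathcomp Require Import boolp classical_sets reals.
From mathcomp Require Import complex mpoly ring.
Set Implicit Arguments.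
Unset Strict Implicit.
Unset Printing Implicit Defensive.
Import Order.TTheory GRing.Theory Num.Theory.
Local Open Scope classical_set_scope.
Local Open Scope ring_scope.

(** In both phases the semistable critical points are, up to G, copies of the
frames of a zero locus, and their orbits are separated by the column space of B.

The semistable locus is found by the usual numerical criterion (semistable_pos,
semistable_neg). For tau > 0 it consists of the (B, omega) with B injective; for
tau < 0, of those with omega nonzero and B, omega without common kernel. Both
descriptions depend on the sign of tau only.

At a critical point shat (B) = 0, and omega annihilates the image of the
differential of shat at B. If B has rank 3, that differential is onto, because the
zero scheme of q_* s is smooth of codimension 3, hence omega = 0 (crit_smooth). So
for tau > 0 the semistable critical points are the (B, 0) with B a basis of a point
of Y. For tau < 0 they have rank 2, and G moves them to ((A | 0), e^3), with A a
basis of the image V of B and e^3 the last coordinate on C^3 (stable_crit_neg). By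
equivariance under diagonal matrices shat is homogeneous of degrees 2, 2, 1 in the
last column (shat_scale_last). It follows that the only remaining equations are the
derivatives of the last component of shat in the last column; as this component is
s (A, (A | w)) at (A | w), they say that p_* s vanishes at V (crit_neg_embedding).

The equivariance of shat is a statement about s: for a fixed basis B of W the
function (u, v) |-> s ((Bu | Bv), B) is alternating bilinear, hence equal to
det (u, v, z) with z the value of q_* s (plane_form_vol). The reason is that a
regular function on an affine line is a polynomial
(locally_rational_univariate), and a section of O(1) over a projective line is
affine in each chart (affine_of_reciprocal).

The two quotients are then compared with the zero loci by one argument
(git_quotient_zero_locus). Inclusion of column spaces is a closed condition, so
points of the semistable critical locus are identified exactly when they have the
same column space, and bases of column spaces can be chosen to depend regularly on
a point of the model or of the Grassmannian. The Calabi--Yau property is carried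
along the isomorphism (calabi_yau3_isomorphic). *)

(** * Algebras of functions *)

Section FunctionAlgebras.
Variables (C : comNzRingType) (T : Type).

(** Polynomial functions and functions regular on an open set are both such
classes, so that closure under determinants, adjugates and substitution into
polynomials is proved once for the two of them. *)
Record subalgebra (P : (T -> C) -> Prop) : Prop := Subalgebra {
  subalgC : forall c, P (fun=> c);
  subalgD : forall f g, P f -> P g -> P (fun x => f x + g x);
  subalgM : forall f g, P f -> P g -> P (fun x => f x * g x) }.

Variables (P : (T -> C) -> Prop) (algP : subalgebra P).

Lemma subalg_sum (I : Type) (r : seq I) (Q : pred I) (f : I -> T -> C) :
  (forall i, Q i -> P (f i)) -> P (fun x => \sum_(i <- r | Q i) f i x).
Proof.
move=> Pf; elim: r => [|i r IHr].
  by under eq_fun do [rewrite big_nil]; apply: (subalgC algP).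
case Qi: (Q i); last by under eq_fun do [rewrite big_cons Qi].
under eq_fun do [rewrite big_cons Qi].
by apply: (subalgD algP) => //; apply: Pf.
Qed.

Lemma subalg_prod (I : Type) (r : seq I) (Q : pred I) (f : I -> T -> C) :
  (forall i, Q i -> P (f i)) -> P (fun x => \prod_(i <- r | Q i) f i x).
Proof.
move=> Pf; elim: r => [|i r IHr].
  by under eq_fun do [rewrite big_nil]; apply: (subalgC algP).
case Qi: (Q i); last by under eq_fun do [rewrite big_cons Qi].
under eq_fun do [rewrite big_cons Qi].
by apply: (subalgM algP) => //; apply: Pf.
Qed.

Lemma subalgX (f : T -> C) n : P f -> P (fun x => f x ^+ n).
Proof.
move=> Pf; elim: n => [|n IHn]; first exact: (subalgC algP).
by under eq_fun do [rewrite exprS]; apply: (subalgM algP).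
Qed.

Lemma subalgN (f : T -> C) : P f -> P (fun x => - f x).
Proof.
move=> Pf; under eq_fun do [rewrite -mulN1r].
by apply: (subalgM algP) => //; apply: (subalgC algP).
Qed.

Lemma subalgB (f g : T -> C) : P f -> P g -> P (fun x => f x - g x).
Proof. by move=> Pf Pg; apply: (subalgD algP) => //; apply: subalgN. Qed.

Lemma subalg_det n (A : T -> 'M[C]_n) :
  (forall i j, P (fun x => A x i j)) -> P (fun x => \det (A x)).
Proof.
move=> PA; apply: subalg_sum => s _; apply: (subalgM algP); first exact: (subalgC algP).
by apply: subalg_prod => i _; apply: PA.
Qed.

Lemma subalg_mulmx m n p (A : T -> 'M[C]_(m, n)) (B : T -> 'M[C]_(n, p)) i j :
  (forall k, P (fun x => A x i k)) -> (forall k, P (fun x => B x k j)) ->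
  P (fun x => (A x *m B x) i j).
Proof.
move=> PA PB; under eq_fun do rewrite mxE.
by apply: subalg_sum => k _; apply: (subalgM algP).
Qed.

Lemma subalg_adj n (A : T -> 'M[C]_n) i j :
  (forall i j, P (fun x => A x i j)) -> P (fun x => (\adj (A x)) i j).
Proof.
move=> PA; under eq_fun do rewrite mxE /cofactor.
apply: (subalgM algP); first exact: (subalgC algP).
by apply: subalg_det => k l; under eq_fun do [rewrite !mxE].
Qed.

Lemma subalg_meval n (p : {mpoly C[n]}) (f : 'I_n -> T -> C) :
  (forall i, P (f i)) -> P (fun x => p.@[fun i => f i x]).
Proof.
move=> Pf; under eq_fun do rewrite mevalE.
apply: subalg_sum => m _; apply: (subalgM algP); first exact: (subalgC algP).
by apply: subalg_prod => i _; apply: subalgX.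
Qed.

End FunctionAlgebras.

(** * Polynomial functions on a vector space *)

Section PolynomialFunctions.
Variable R : realType.
Local Notation C := R[i].

Definition polyfun (vT : vectType C) (f : vT -> C) :=
  exists p : {mpoly C[\dim {:vT}]}, f =1 peval p.

Lemma polyfun_alg (vT : vectType C) : subalgebra (@polyfun vT).
Proof.
split=> [c|f g [p Ep] [q Eq]|f g [p Ep] [q Eq]].
- by exists c%:MP => x; rewrite /peval mevalC.
- by exists (p + q) => x; rewrite Ep Eq /peval mevalD.
- by exists (p * q) => x; rewrite Ep Eq /peval mevalM.
Qed.

(** Polynomial functions are built from the coordinates by the operations of an
algebra. *)
Lemma polyfun_comp_subalg (T : Type) (P : (T -> C) -> Prop) (vT : vectType C)
    (phi : T -> vT) (f : vT -> C) :
  subalgebra P -> (forall i, P (fun x => coord (vbasis {:vT}) i (phi x))) ->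
  polyfun f -> P (f \o phi).
Proof.
move=> algP Pphi [p Ep]; have -> : f \o phi = fun x => p.@[fun i =>
  coord (vbasis {:vT}) i (phi x)] by apply/funext=> x; rewrite /= Ep.
exact: subalg_meval.
Qed.

Lemma linear_form_coord (vT : vectType C) (l : vT -> C) :
  scalar l -> forall v, l v = \sum_i coord (vbasis {:vT}) i v * l (vbasis {:vT})`_i.
Proof.
move=> lin_l v.
have l0 : l 0 = 0.
  have /eqP := lin_l 1 0 0; rewrite scaler0 addr0 mul1r -subr_eq0 opprD.
  by rewrite addrA subrr sub0r oppr_eq0 => /eqP.
rewrite {1}(coord_vbasis (memvf v)).
elim/big_rec2: _ => // i u c _ <-; exact: lin_l.
Qed.

Lemma polyfun_linear (vT : vectType C) (l : vT -> C) : scalar l -> polyfun l.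
Proof.
move=> lin_l; have -> : l = fun v => \sum_i coord (vbasis {:vT}) i v * l (vbasis {:vT})`_i.
  by apply/funext => v; apply: linear_form_coord.
apply: (subalg_sum (polyfun_alg vT)) => i _; apply: (subalgM (polyfun_alg vT)).
  by exists 'X_i => v; rewrite /peval mevalXU.
exact: (subalgC (polyfun_alg vT)).
Qed.

End PolynomialFunctions.

(** * Restriction of polynomial and regular functions to lines *)

Section Lines.
Variable R : realType.
Local Notation C := R[i].

Lemma poly_fun_eq0 (P : {poly C}) : (forall t, P.[t] = 0) -> P = 0.
Proof.
move=> P0; pose rs : seq C := [seq n%:R | n <- iota 0 (size P)].
apply: (@roots_geq_poly_eq0 _ P rs); last by rewrite size_map size_iota.
  by apply/allP => x _; rewrite rootE P0.
rewrite map_inj_uniq ?iota_uniq // => m n /eqP.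
by rewrite eqr_nat => /eqP.
Qed.

Lemma poly_fun_inj (P Q : {poly C}) : (forall t, P.[t] = Q.[t]) -> P = Q.
Proof.
by move=> PQ; apply/subr0_eq/poly_fun_eq0 => t; rewrite hornerD hornerN PQ subrr.
Qed.

Lemma univariate_alg : subalgebra (fun f : C -> C => exists P : {poly C}, f =1 horner P).
Proof.
split=> [c|f g [p Ep] [q Eq]|f g [p Ep] [q Eq]].
- by exists c%:P => x; rewrite hornerC.
- by exists (p + q) => x; rewrite Ep Eq hornerD.
- by exists (p * q) => x; rewrite Ep Eq hornerM.
Qed.

Lemma polyfun_univariate (f : C^o -> C) :
  polyfun f -> exists P : {poly C}, f =1 horner P.
Proof.
move=> pf; apply: (polyfun_comp_subalg (phi := id : C -> C^o) univariate_alg _ pf) => i.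
exists ((coord (vbasis {: C^o}) i 1) *: 'X) => t.
by rewrite hornerZ hornerX mulrC -linearZ /= [t *: _]mulr1.
Qed.

Lemma polyfun_line (vT : vectType C) (f : vT -> C) x y : polyfun f ->
  exists P : {poly C}, forall t, f (x + t *: y) = P.[t].
Proof.
move=> pf.
apply: (polyfun_comp_subalg (phi := fun t => x + t *: y) univariate_alg _ pf) => i.
exists ((coord (vbasis {: vT}) i x)%:P + coord (vbasis {:vT}) i y *: 'X) => t.
by rewrite hornerD hornerC hornerZ hornerX linearD linearZ /= mulrC.
Qed.

(** The identity principle: restrict both functions to the line joining x to a
point where d does not vanish, and use that {poly C} is a domain. *)
Lemma polyfun_dense (vT : vectType C) (f d : vT -> C) a :
  polyfun f -> polyfun d -> d a != 0 ->
  (forall x, d x != 0 -> f x = 0) -> forall x, f x = 0.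
Proof.
move=> pf pd da0 fd x.
have [P EP] := polyfun_line x (a - x) pf.
have [D ED] := polyfun_line x (a - x) pd.
have : P * D = 0.
  apply: poly_fun_eq0 => t; rewrite hornerM -EP -ED.
  have [->|/fd->] := eqVneq (d (x + t *: (a - x))) 0; first by rewrite mulr0.
  by rewrite mul0r.
move=> /eqP; rewrite mulf_eq0 => /orP[] /eqP E0.
  by rewrite -[x]addr0 -(scale0r (a - x)) EP E0 horner0.
move: da0; have -> : a = x + 1 *: (a - x) by rewrite scale1r addrC subrK.
by rewrite ED E0 horner0 eqxx.
Qed.

(** The chain rule along a line: the first-order coefficient of p (v + t u) is
the differential of p at v applied to u. *)
Lemma directional_derivative (vT : vectType C) (p : {mpoly C[\dim {:vT}]}) v u :
  exists2 P : {poly C}, forall t, peval p (v + t *: u) = P.[t] &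
    P`_1 = \sum_i coord (vbasis {:vT}) i u * peval p^`M(i) v.
Proof.
pose Q (p : {mpoly C[\dim {:vT}]}) := exists2 P : {poly C},
  forall t, peval p (v + t *: u) = P.[t] &
    P`_1 = \sum_i coord (vbasis {:vT}) i u * peval p^`M(i) v.
have QC c : Q c%:MP.
  exists c%:P => [t|]; first by rewrite /peval mevalC hornerC.
  by rewrite coefC big1 // => i _; rewrite mderivC /peval meval0 mulr0.
have QD f g : Q f -> Q g -> Q (f + g).
  move=> [F EF F1] [G EG G1]; exists (F + G) => [t|].
    by rewrite hornerD -EF -EG /peval mevalD.
  rewrite coefD F1 G1 -big_split; apply: eq_bigr => i _ /=.
  by rewrite mderivD /peval mevalD mulrDr.
have QM f g : Q f -> Q g -> Q (f * g).
  move=> [F EF F1] [G EG G1]; exists (F * G) => [t|].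
    by rewrite hornerM -EF -EG /peval mevalM.
  have F0 : F`_0 = peval f v by rewrite -horner_coef0 -EF scale0r addr0.
  have G0 : G`_0 = peval g v by rewrite -horner_coef0 -EG scale0r addr0.
  rewrite coefM big_ord_recl big_ord1 /= F0 G0 F1 G1 mulr_sumr mulr_suml -big_split.
  apply: eq_bigr => i _ /=; rewrite mderivM /peval mevalD !mevalM mulrDr addrC.
  by rewrite -mulrA; congr (_ + _); rewrite mulrCA.
have QX i : Q 'X_i.
  exists ((coord (vbasis {:vT}) i v)%:P + coord (vbasis {:vT}) i u *: 'X) => [t|].
    rewrite /peval mevalXU hornerD hornerC hornerZ hornerX.
    by rewrite linearD linearZ /= mulrC.
  rewrite coefD coefC coefZ coefX mulr1 add0r (bigD1 i) //= big1 ?addr0.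
    rewrite mderivX mnm1E eqxx scale1r -{1}[U_(i)%MM]addm0.
    by rewrite addmC addmK mpolyX0 /peval meval1 mulr1.
  by move=> j ji; rewrite mderivX mnm1E eq_sym (negPf ji) scale0r /peval meval0 mulr0.
elim/mpolyind: p; first by rewrite -mpolyC0; apply: QC.
move=> c m p _ _ Qp; apply: (QD) => //; rewrite -mul_mpolyC; apply: (QM) => //.
rewrite mpolyXE_id; apply: (big_ind Q); [exact: (QC 1) | exact: QM |].
move=> i _; elim: (m i) => [|n IHn]; first exact: (QC 1).
by rewrite exprS; apply: QM.
Qed.

(** This frees the critical locus from the choice of a basis. *)
Lemma critP (vT : vectType C) (w : vT -> C) v : polyfun w ->
  crit w v <-> forall u, exists2 P : {poly C},
    forall t, w (v + t *: u) = P.[t] & P`_1 = 0.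
Proof.
move=> pw; split=> [[p Ew p0] u|wu].
  have [P EP P1] := directional_derivative p v u.
  exists P => [t|]; first by rewrite Ew EP.
  by rewrite P1 big1 // => i _; rewrite p0 mulr0.
have [p Ew] := pw; exists p => // i.
have [P EP P1] := wu (vbasis {:vT})`_i.
have [Q EQ Q1] := directional_derivative p v (vbasis {:vT})`_i.
have PQ : P = Q by apply: poly_fun_inj => t; rewrite -EP -EQ Ew.
move: P1; rewrite PQ Q1 (bigD1 i) //= big1 ?addr0 => [|j ji].
  by rewrite coord_free ?eqxx ?mul1r // (basis_free (vbasisP _)).
by rewrite coord_free ?(basis_free (vbasisP _)) // eq_sym (negPf ji) mul0r.
Qed.

(** Two coprime representatives of a function that is locally a quotient of
polynomials have a denominator without roots. *)
Lemma locally_rational_univariate (F : C -> C) :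
  (forall t0, exists p q : {poly C}, q.[t0] != 0 /\
     forall t, q.[t] != 0 -> F t = p.[t] / q.[t]) ->
  exists P : {poly C}, F =1 horner P.
Proof.
move=> locF; have [p0 [q0 [q00 F0]]] := locF 0.
have q0n0 : q0 != 0 by apply: contraNneq q00 => ->; rewrite horner0.
pose d := gcdp p0 q0; pose p := p0 %/ d; pose q := q0 %/ d.
have dn0 : d != 0 by rewrite gcdp_eq0 (negPf q0n0) andbF.
have Ep : p0 = p * d by rewrite divpK // dvdp_gcdl.
have Eq : q0 = q * d by rewrite divpK // dvdp_gcdr.
have cop : coprimep p q by rewrite coprimep_div_gcd // q0n0 orbT.
have crossE p' q' : q' != 0 ->
    (forall t, q'.[t] != 0 -> F t = p'.[t] / q'.[t]) -> p * q' = p' * q.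
  move=> q'n0 F'; apply/subr0_eq/eqP.
  suff /eqP : (p * q' - p' * q) * (q0 * q') = 0.
    by rewrite !mulf_eq0 (negPf q0n0) (negPf q'n0) !orbF.
  apply: poly_fun_eq0 => t; rewrite !(hornerM, hornerD, hornerN).
  have [->|q0t] := eqVneq q0.[t] 0; first by rewrite mul0r mulr0.
  have [->|q't] := eqVneq q'.[t] 0; first by rewrite !mulr0.
  have := F0 t q0t; rewrite (F' t q't) Ep Eq !hornerM.
  move: q0t; rewrite Eq hornerM mulf_eq0 negb_or => /andP[qt dt] /eqP.
  rewrite -mulf_div divff // mulr1 eqr_div // => /eqP <-.
  by rewrite subrr mul0r.
(* At a root of q another representative p'/q' is defined; cross-multiplication
   makes the root common to p and q. *)
have q1 : size q = 1%N.
  apply/eqP; apply: contraT => /closed_rootP[a qa].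
  have [p' [q' [q'a F']]] := locF a.
  have q'n0 : q' != 0 by apply: contraNneq q'a => ->; rewrite horner0.
  have /(congr1 (fun P => P.[a])) := crossE _ _ q'n0 F'.
  rewrite !hornerM (rootP qa) mulr0 => /eqP; rewrite mulf_eq0 (negPf q'a) orbF => pa.
  by have := coprimep_root cop pa; rewrite (rootP qa) eqxx.
have /size_poly1P [c c0 Eqc] : size q == 1%N by rewrite q1.
exists (c^-1 *: p) => t; have [p' [q' [q't F']]] := locF t.
have q'n0 : q' != 0 by apply: contraNneq q't => ->; rewrite horner0.
have /(congr1 (fun P => P.[t])) := crossE _ _ q'n0 F'.
rewrite F' // hornerZ Eqc !hornerM hornerC => E.
apply: (mulIf q't); rewrite mulfVK // -mulrA E [p'.[t] * c]mulrC mulrA.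
by rewrite mulVf // mul1r.
Qed.

(** P and Q are the two expressions of a section of O(1) on the projective line;
the coefficients of t ^ n * P are compared with those of t times the reversal
of Q. *)
Lemma affine_of_reciprocal (P Q : {poly C}) :
  (forall t, t != 0 -> P.[t] = t * Q.[t^-1]) ->
  forall t, P.[t] = P.[0] + t * Q.[0].
Proof.
move=> PQ; pose n := size Q; pose Qr := \sum_(k < n) Q`_k *: 'X^(n - k) : {poly C}.
have E : 'X^n * P = 'X * Qr.
  apply: poly_fun_inj => t; rewrite !hornerM hornerXn hornerX.
  have [->|t0] := eqVneq t 0.
    rewrite mul0r; have [n0|n0] := posnP n; last by rewrite expr0n gtn_eqF // mul0r.
    have Q0 : Q = 0 by apply/eqP; rewrite -size_poly_eq0 -/n n0.
    suff -> : P = 0 by rewrite horner0 mulr0.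
    suff /eqP : P * 'X = 0 by rewrite mulf_eq0 polyX_eq0 orbF => /eqP.
    apply: poly_fun_eq0 => x; rewrite hornerM hornerX.
    have [->|x0] := eqVneq x 0; first by rewrite mulr0.
    by rewrite PQ // Q0 horner0 mulr0 mul0r.
  rewrite PQ // mulrCA; congr (_ * _).
  rewrite horner_coef mulr_sumr horner_sum; apply: eq_bigr => k _.
  by rewrite hornerZ hornerXn exprB ?unitfE // ?(ltnW (ltn_ord k)) // mulrCA exprVn.
have -> : P = P.[0]%:P + Q.[0] *: 'X.
  apply/polyP => j; have /(congr1 (fun p : {poly C} => p`_(n + j))) := E.
  rewrite mulrC coefMXn ltnNge leq_addr /= addKn.
  rewrite coefXM coefD coefC coefZ coefX !horner_coef0.
  case: j => [|j]; first by move=> _; rewrite /= mulr0 addr0.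
  rewrite addnS /= => ->; rewrite coef_sum add0r.
  case: j => [|j] /=; last first.
    rewrite mulr0 big1 // => k _; rewrite coefZ coefXn.
    have -> : (n + j.+1 == n - k)%N = false.
      by apply: gtn_eqF; rewrite addnS ltnS (leq_trans (leq_subr _ _)) // leq_addr.
    by rewrite mulr0.
  rewrite addn0 mulr1; have [n0|n0] := posnP n.
    rewrite big1 => [|k]; first by rewrite nth_default // -/n n0.
    by have := ltn_ord k; rewrite {2}n0.
  rewrite (bigD1 (Ordinal n0)) //= subn0 coefZ coefXn eqxx mulr1 big1 ?addr0 //.
  move=> k k0; rewrite coefZ coefXn; have -> : (n == n - k)%N = false.
    apply: gtn_eqF; rewrite ltn_subrL n0 andbT lt0n.
    by apply: contraNneq k0 => k0; apply/eqP/val_inj.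
  by rewrite mulr0.
by move=> t; rewrite !(hornerD, hornerC, hornerZ, hornerX) mulr0 addr0 mulrC.
Qed.

End Lines.

(** * Spaces with a sheaf of functions *)

Section Sheaves.
Variable R : realType.
Local Notation C := R[i].

(** The part of the axioms of a topological space with a sheaf of functions that
gluing arguments use; unions of open sets are phrased locally. *)
Record sheafy (X : Defs.space R) : Prop := Sheafy {
  openI : forall U V : set X, isopen U -> isopen V -> isopen (U `&` V);
  open_local : forall U : set X,
    (forall x, U x -> exists W : set X, [/\ isopen W, W x & W `<=` U]) -> isopen U;
  regular_local : forall (U : set X) f, isopen U ->
    (forall x, U x -> exists (W : set X) g,
       [/\ isopen W, W x, regular W g & forall y, W y -> U y -> f y = g y]) ->
    regular U f }.

Lemma regular_restrict (X : Defs.space R) (U V : set X) f : sheafy X ->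
  isopen U -> isopen V -> V `<=` U -> regular U f -> regular V f.
Proof.
by move=> shX oU oV VU fU; apply: regular_local => // x Vx; exists U, f; split=> //; apply: VU.
Qed.

Lemma affine_sheafy (vT : vectType C) : sheafy (affine vT).
Proof.
split=> [U V oU oV x [Ux Vx]|U locU x Ux|U f _ locf x Ux].
- have [p px pU] := oU x Ux; have [q qx qV] := oV x Vx.
  exists (p * q) => [|y]; rewrite /peval mevalM; first exact: mulf_neq0.
  by rewrite mulf_eq0 negb_or => /andP[py qy]; split; [apply: pU | apply: qV].
- have [W [oW Wx WU]] := locU x Ux; have [p px pW] := oW x Wx.
  by exists p => // y /pW; apply: WU.
- have [W [g [oW Wx gW fg]]] := locf x Ux; have [r rx rW] := oW x Wx.
  have [p [q [qx gpq]]] := gW x Wx; exists (p * r), (q * r).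
  rewrite /peval !mevalM; split=> [|y Uy]; first exact: mulf_neq0.
  rewrite /peval !mevalM mulf_eq0 negb_or => /andP[qy ry].
  have Wy : W y by apply: rW.
  by rewrite fg // gpq // -mulf_div divff // mulr1.
Qed.

Lemma subspace_sheafy (X : Defs.space R) (A : set X) : sheafy X -> sheafy (subspace A).
Proof.
move=> shX; split=> [U V [U' oU' ->] [V' oV' ->]|U locU|U f [U' oU' EU] locf x Ux].
- by exists (U' `&` V'); first exact: openI.
- exists [set x | exists V : set X, [/\ isopen V, V x & @sval X A @^-1` V `<=` U]].
    apply: (open_local shX) => x [V [oV Vx VU]]; exists V; split=> // y Vy.
    by exists V.
  apply/seteqP; split=> [x Ux|x [V [_ Vx VU]]]; last exact: VU.
  by have [W [[V oV ->] Wx WU]] := locU x Ux; exists V.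
- have [W [g [[W' oW' EW] Wx gW fg]]] := locf x Ux.
  have [V [h [oV Vx hV gh]]] := gW x Wx; exists (V `&` U'), h; split.
  + exact: openI.
  + by split=> //; rewrite EU in Ux.
  + by apply: (regular_restrict shX oV (openI shX oV oU') _ hV) => y [].
  + move=> y [Vy U'y]; have [Wy ghy] := gh y Vy.
    have Uy : U y by rewrite EU.
    by rewrite fg.
Qed.

Lemma quotient_sheafy (X : Defs.space R) (E : X -> X -> Prop) :
  sheafy X -> sheafy (quotient E).
Proof.
move=> shX; split=> [U V oU oV|U locU|U f oU locf].
- exact: (openI shX oU oV).
- apply: (open_local shX) => x Ux; have [W [oW Wx WU]] := locU _ Ux.
  by exists (eqclass E @^-1` W); split=> // y; apply: WU.
- apply: (regular_local shX) => // x Ux; have [W [g [oW Wx gW fg]]] := locf _ Ux.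
  by exists (eqclass E @^-1` W), (g \o eqclass E); split=> // y; apply: fg.
Qed.

(** The local extensions that define regular functions on a subspace pull back
to regular functions; they glue because X carries a sheaf. *)
Lemma morphism_subspace (X Y : Defs.space R) (A : set Y) (f : X -> subspace A) :
  sheafy X -> morphism (fun x => sval (f x) : Y) -> morphism f.
Proof.
move=> shX mf V [V' oV' EV].
have oU : isopen (f @^-1` V) by rewrite EV; have [] := mf V' oV'.
split=> // h hV; apply: regular_local => // x Vx.
have [V0 [h0 [oV0 V0x h0V0 hh0]]] := hV _ Vx.
have [oW rW] := mf V0 oV0; exists ((fun x => sval (f x) : Y) @^-1` V0).
exists (h0 \o (fun x => sval (f x))); split=> //; first exact: rW.
by move=> y V0y _; have [] := hh0 _ V0y.
Qed.

Lemma subspace_inj (X : Defs.space R) (A : set X) (x y : subspace A) :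
  sval x = sval y -> x = y.
Proof. by case: x y => x Ax [y Ay] /= E; apply: eq_exist. Qed.

Lemma quotient_repr (X : Defs.space R) (E : X -> X -> Prop) (c : quotient E) :
  exists x, c = eqclass E x.
Proof. by case: c => c [x Ex]; exists x; apply: eq_exist. Qed.

(** A class is by construction the set of all elements to which some x is
related, and such an x is chosen here. *)
Definition repr (X : Defs.space R) (E : X -> X -> Prop) (c : quotient E) : X :=
  sval (cid (quotient_repr c)).

Lemma reprK (X : Defs.space R) (E : X -> X -> Prop) (c : quotient E) :
  eqclass E (repr c) = c.
Proof. by rewrite /repr; case: cid. Qed.

Lemma eqclass_eq (X : Defs.space R) (E : X -> X -> Prop) (x y : X) :
  (forall z, E z z) -> (forall u v, E u v -> E v u) ->
  (forall u v w, E u v -> E v w -> E u w) ->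
  eqclass E x = eqclass E y <-> E x y.
Proof.
move=> Er Es Et; split=> [/(congr1 sval)/= -> //|Exy].
apply: eq_exist; apply/seteqP; split=> z Ez; first by apply: Et Ez; apply: Es.
exact: Et Ez.
Qed.

End Sheaves.

(** * Invariance of the Calabi--Yau property under isomorphism *)

Section CalabiYauTransport.
Variable R : realType.
Local Notation C := R[i].

Lemma morphism_comp (X Y Z : Defs.space R) (f : X -> Y) (g : Y -> Z) :
  morphism f -> morphism g -> morphism (g \o f).
Proof.
move=> mf mg V oV; have [oW rW] := mg V oV; have [oU rU] := mf _ oW.
by split=> // h hV; apply: (rU (h \o g)); apply: rW.
Qed.

Lemma isomorphic_sym (X Y : Defs.space R) : isomorphic X Y -> isomorphic Y X.
Proof. by move=> [f [g [mf mg fK gK]]]; exists g, f. Qed.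

Lemma isomorphic_trans (X Y Z : Defs.space R) :
  isomorphic X Y -> isomorphic Y Z -> isomorphic X Z.
Proof.
move=> [f [g [mf mg fK gK]]] [f' [g' [mf' mg' fK' gK']]].
exists (f' \o f), (g \o g'); split; try exact: morphism_comp.
  exact: can_comp.
exact: can_comp.
Qed.

Lemma germ_morphism (X Y : Defs.space R) (f : X -> Y) x h :
  morphism f -> germ (f x) h -> germ x (h \o f).
Proof.
move=> mf [U [oU Ux hU]]; have [oV rV] := mf U oU.
by exists (f @^-1` U); split=> //; apply: rV.
Qed.

Lemma derivation_pushforward (X Y : Defs.space R) (f : X -> Y) x D :
  morphism f -> derivation x D -> derivation (f x) (fun h => D (h \o f)).
Proof.
move=> mf dD h k gh gk.
have [D1 D2 D3] := dD _ _ (germ_morphism mf gh) (germ_morphism mf gk); split=> //.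
move=> [U [oU Ux hk]]; apply: D1; exists (f @^-1` U); have [oV _] := mf U oU.
by split=> // y; apply: hk.
Qed.

(** Derivations are pushed forward along f and forms are pulled back along its
inverse. Cocycles live on pairwise intersections, which have to be open for the
morphism property to apply to them. *)
Lemma calabi_yau3_isomorphic (X Y : Defs.space R) :
  (forall U V : set Y, isopen U -> isopen V -> isopen (U `&` V)) ->
  isomorphic X Y -> calabi_yau3 X -> calabi_yau3 Y.
Proof.
move=> oI isoXY [projX [[x0 _] irrX] tanX [alpha [alphaX nzX]] H1X].
have [f [g [mf mg fK gK]]] := isoXY.
have gfE (h : X -> C) : (h \o g) \o f = h by apply/funext => x; rewrite /= fK.
have fgE (h : Y -> C) : (h \o f) \o g = h by apply/funext => x; rewrite /= gK.
split.
- have [n [A [oA isoA]]] := projX; exists n, A; split=> //.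
  exact: isomorphic_trans (isomorphic_sym isoXY) isoA.
- split=> [|U V oU oV [u Uu] [v Vv]]; first by exists (f x0).
  have [oU' _] := mf U oU; have [oV' _] := mf V oV.
  have [||x [Ux Vx]] := irrX _ _ oU' oV'; last by exists (f x).
    by exists (g u); rewrite /= gK.
  by exists (g v); rewrite /= gK.
- move=> y; have [D [dD uD]] := tanX (g y); exists (fun i h => D i (h \o f)).
  split=> [i|E dE]; first by rewrite -{1}[y]gK; apply: derivation_pushforward.
  have [c [Ec uc]] := uD _ (derivation_pushforward mg dE); exists c.
  split=> [h gh|c' Ec'].
    rewrite -{1}[h]fgE; apply: (Ec (h \o f)).
    by apply: germ_morphism; rewrite ?gK.
  apply: uc => h gh; rewrite Ec'; last by apply: germ_morphism.
  by apply: eq_bigr => i _; rewrite gfE.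
- exists (fun y D => alpha (g y) (fun i k => D i (k \o g))); split=> y.
    have [U [h [t [oU Uy hU tU Ealpha]]]] := alphaX (g y).
    have [oV rV] := mg U oU.
    exists (g @^-1` U), (h \o g), (fun j => t j \o g); split=> //.
    + exact: rV.
    + by move=> j; apply: rV.
    + move=> z D Uz dD; rewrite Ealpha // => i.
      exact: derivation_pushforward.
  have [D dD nzD] := nzX (g y); exists (fun i h => D i (h \o f)).
    by move=> i; rewrite -{1}[y]gK; apply: derivation_pushforward.
  suff -> : (fun i (k : X -> C) => D i ((k \o g) \o f)) = D by [].
  by apply/funext => i; apply/funext => k; rewrite gfE.
- move=> I U h oU covU hU cocy.
  have [|||i j k x|k [kU Ek]] := H1X I (fun i => f @^-1` (U i)) (fun i j => h i j \o f).
  + by move=> i; have [] := mf _ (oU i).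
  + by move=> x; apply: covU.
  + by move=> i j; have [_ rV] := mf _ (oI _ _ (oU i) (oU j)); apply: rV.
  + exact: cocy.
  exists (fun i => k i \o g); split=> [i|i j y Ui Uj].
    have [oV _] := mf _ (oU i); have [_ rW] := mg _ oV.
    suff -> : U i = g @^-1` (f @^-1` U i) by apply: rW.
    by apply/seteqP; split=> y /=; rewrite gK.
  by rewrite /= -Ek /= ?gK.
Qed.

End CalabiYauTransport.

(** * Regular maps between vector spaces *)

Section RegularMaps.
Variable R : realType.
Local Notation C := R[i].

Section Coordinates.
Variables (T : Type) (P : (T -> C) -> Prop) (algP : subalgebra P).

(** With P the class of polynomial, respectively regular, functions this says
that phi is a polynomial, respectively regular, map. *)
Definition coords_in (vT : vectType C) (phi : T -> vT) :=
  forall i, P (fun x => coord (vbasis {:vT}) i (phi x)).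

Lemma coords_in_polyfun (vT : vectType C) (phi : T -> vT) (f : vT -> C) :
  coords_in phi -> polyfun f -> P (fun x => f (phi x)).
Proof. by move=> Pphi pf; apply: (polyfun_comp_subalg algP Pphi pf). Qed.

Lemma coords_in_linear (vT : vectType C) (phi : T -> vT) (l : vT -> C) :
  coords_in phi -> scalar l -> P (fun x => l (phi x)).
Proof. by move=> Pphi lin_l; apply: (coords_in_polyfun Pphi); apply: polyfun_linear. Qed.

Lemma coords_in_pair (vT wT : vectType C) (phi : T -> vT) (psi : T -> wT) :
  coords_in phi -> coords_in psi -> coords_in (fun x => (phi x, psi x) : (vT * wT)%type).
Proof.
move=> Pphi Ppsi i; pose l := coord (vbasis {: (vT * wT)%type}) i.
have -> : (fun x => l (phi x, psi x)) = fun x => l (phi x, 0) + l (0, psi x).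
  by apply/funext => x; rewrite -linearD; congr (l _); congr pair; rewrite /= ?addr0 ?add0r.
apply: (subalgD algP).
  apply: (coords_in_linear (l := fun v => l (v, 0)) Pphi) => a u v.
  by rewrite -linearP; congr (l _); congr pair; rewrite /= scaler0 addr0.
apply: (coords_in_linear (l := fun v => l (0, v)) Ppsi) => a u v.
by rewrite -linearP; congr (l _); congr pair; rewrite /= scaler0 addr0.
Qed.

Lemma coords_in_mx m n (phi : T -> 'M[C]_(m, n)) :
  (forall i j, P (fun x => phi x i j)) -> coords_in phi.
Proof.
move=> Pphi k; pose l := coord (vbasis {: 'M[C]_(m, n)}) k.
have -> : (fun x => l (phi x)) = fun x => \sum_i \sum_j phi x i j * l (delta_mx i j).
  apply/funext => x; rewrite {1}[phi x]matrix_sum_delta /l raddf_sum.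
  apply: eq_bigr => i _ /=; rewrite raddf_sum.
  by apply: eq_bigr => j _; rewrite /= linearZ.
apply: (subalg_sum algP) => i _; apply: (subalg_sum algP) => j _.
apply: (subalgM algP); [exact: Pphi | exact: (subalgC algP)].
Qed.

End Coordinates.

Variable vT : vectType C.
Implicit Types (D : set (affine vT)) (f g : vT -> C).

Lemma polyfun_regular D f : polyfun f -> regular D f.
Proof.
move=> [p Ep] x _; exists p, 1; rewrite /peval meval1 oner_neq0; split=> // y _ _.
by rewrite Ep /peval meval1 divr1.
Qed.

Lemma regular_alg D : subalgebra (regular (s := affine vT) D).
Proof.
split=> [c|f g rf rg x Dx|f g rf rg x Dx].
- exact: polyfun_regular (subalgC (polyfun_alg vT) c).
- have [p [q [qx fpq]]] := rf x Dx; have [p' [q' [q'x gpq]]] := rg x Dx.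
  exists (p * q' + p' * q), (q * q'); rewrite /peval mevalM.
  split=> [|y Dy]; first exact: mulf_neq0.
  rewrite mevalD !mevalM mulf_eq0 negb_or => /andP[qy q'y].
  by rewrite fpq // gpq // addf_div.
- have [p [q [qx fpq]]] := rf x Dx; have [p' [q' [q'x gpq]]] := rg x Dx.
  exists (p * p'), (q * q'); rewrite /peval mevalM.
  split=> [|y Dy]; first exact: mulf_neq0.
  rewrite !mevalM mulf_eq0 negb_or => /andP[qy q'y].
  by rewrite fpq // gpq // mulf_div.
Qed.

Lemma regular_inv D f :
  regular D f -> (forall x, D x -> f x != 0) -> regular D (fun x => (f x)^-1).
Proof.
move=> rf f0 x Dx; have [p [q [qx fpq]]] := rf x Dx.
exists (q * q), (p * q); rewrite /peval !mevalM.
have px : p.@[fun i => coord (vbasis fullv) i x] != 0.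
  by have := f0 x Dx; rewrite fpq // mulf_eq0 negb_or => /andP[].
split=> [|y Dy]; first exact: mulf_neq0.
rewrite !mevalM mulf_eq0 negb_or => /andP[py qy].
by rewrite fpq // invf_div -mulf_div divff // mulr1.
Qed.

(** A regular function is a local quotient p/q, so near x its non-vanishing set
contains the set where p, q and an equation of the complement of D do not vanish. *)
Lemma open_nonzero D f :
  isopen D -> regular D f -> isopen (D `&` [set x | f x != 0] : set (affine vT)).
Proof.
move=> oD rf x [Dx fx]; have [r rx rD] := oD x Dx; have [p [q [qx fpq]]] := rf x Dx.
exists (r * (p * q)) => [|y]; rewrite /peval !mevalM.
  rewrite !mulf_neq0 //; move: fx; rewrite /= fpq // mulf_eq0 negb_or.
  by case/andP.
rewrite !mulf_eq0 !negb_or => /and3P[ry py qy].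
have Dy : D y by apply: rD.
by split=> //=; rewrite fpq // mulf_neq0 ?invr_eq0.
Qed.

Lemma openT : isopen (setT : set (affine vT)).
Proof. by move=> x _; exists 1 => //; rewrite /peval meval1 oner_neq0. Qed.

Lemma open_polyfun f : polyfun f -> isopen ([set x | f x != 0] : set (affine vT)).
Proof.
move=> pf; rewrite -[X in isopen X]setTI.
by apply: open_nonzero; [apply: openT | apply: polyfun_regular].
Qed.

Definition regmap (wT : vectType C) D (phi : vT -> wT) :=
  coords_in (regular (s := affine vT) D) phi.

Lemma open_preimage (wT : vectType C) D (phi : vT -> wT) (V : set (affine wT)) :
  isopen D -> regmap D phi -> isopen V -> isopen (D `&` phi @^-1` V : set (affine vT)).
Proof.
move=> oD rphi oV; apply: (open_local (affine_sheafy vT)) => x [Dx Vx].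
have [p px pV] := oV _ Vx.
exists (D `&` [set y | peval p (phi y) != 0]); split=> //.
  apply: open_nonzero => //; apply: (coords_in_polyfun (regular_alg D) rphi).
  by exists p.
by move=> y [Dy py]; split=> //; apply: pV.
Qed.

(** Write h locally as p/q: then p and q composed with phi are regular on D, and
so is their quotient where the denominator does not vanish. *)
Lemma regular_comp (wT : vectType C) D (phi : vT -> wT) (V : set (affine wT)) h :
  isopen D -> regmap D phi -> isopen V -> regular V h ->
  regular (D `&` phi @^-1` V : set (affine vT)) (fun x => h (phi x)).
Proof.
move=> oD rphi oV rh; have oW := open_preimage oD rphi oV.
have shA := affine_sheafy vT.
apply: (regular_local shA oW) => x [Dx Vx].
have [p [q [qx hpq]]] := rh _ Vx.
have poly_phi r : regular (D : set (affine vT)) (fun y => peval r (phi y)).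
  by apply: (coords_in_polyfun (regular_alg D) rphi); exists r.
pose W : set (affine vT) := D `&` [set y | peval q (phi y) != 0].
have oW' : isopen W := open_nonzero oD (poly_phi q).
have WD : W `<=` D by move=> y [].
exists W, (fun y => peval p (phi y) * (peval q (phi y))^-1); split=> //.
  apply: (subalgM (regular_alg W)); first exact: (regular_restrict shA oD oW' WD).
  apply: regular_inv => [|y []//]; exact: (regular_restrict shA oD oW' WD).
by move=> y [_ qy] [_ Vy]; rewrite hpq.
Qed.

End RegularMaps.

(** * The volume form of a three-dimensional space *)

Section Volume.
Variable K : fieldType.
Implicit Types u v z : 'cV[K]_3.

Definition vol u v z : K :=
  \det (\matrix_(i < 3, j < 3) [:: u i 0; v i 0; z i 0]`_j).

Lemma vol_mulmx (g : 'M[K]_3) u v z :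
  vol (g *m u) (g *m v) (g *m z) = \det g * vol u v z.
Proof.
rewrite /vol -det_mulmx; congr (\det _); apply/matrixP => i j; rewrite !mxE.
case: j => -[|[|[|//]]] ? /=; rewrite ?mxE; apply: eq_bigr => k _; by rewrite !mxE.
Qed.

Lemma volE u v z : vol u v z =
  (u 1 0 * v 2%:R 0 - u 2%:R 0 * v 1 0) * z 0 0 +
  (u 2%:R 0 * v 0 0 - u 0 0 * v 2%:R 0) * z 1 0 +
  (u 0 0 * v 1 0 - u 1 0 * v 0 0) * z 2%:R 0.
Proof.
rewrite /vol; set M := \matrix_(i, j) _.
have det2 (A : 'M[K]_2) : \det A = A 0 0 * A 1 1 - A 0 1 * A 1 0.
  rewrite (expand_det_row _ 0) !big_ord_recl big_ord0 addr0 /cofactor !det_mx11 !mxE /=.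
  rewrite !(expr0, expr1, mulN1r, mul1r, mulrN).
  by congr (_ * A _ _ - A _ _ * A _ _); apply: val_inj.
rewrite (expand_det_col _ 2%:R) !big_ord_recl big_ord0 addr0 /cofactor !det2 !mxE /=.
have valued (w : 'cV[K]_3) : exists f : nat -> K, forall i, w i 0 = f i.
  by exists (fun n => w (inord n) 0) => i; rewrite inord_val.
have [[fu Eu] [[fv Ev] [fz Ez]]] := (valued u, (valued v, valued z)).
rewrite !(Eu, Ev, Ez) /=.
have mod12 : (1 %% 2 = 1)%N by [].
have mod13 : (1 %% 3 = 1)%N by [].
have mod23 : ((1 + 1) %% 3 = 2)%N by [].
rewrite /bump /= !(mod12, mod13, mod23, addn0, add0n).
ring.
Qed.

Lemma volZ u v z a : vol u v (a *: z) = a * vol u v z.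
Proof. rewrite !volE ![(a *: z) _ _]mxE; ring. Qed.

(** The index is read modulo 3, like the indices of qpush. *)
Definition basis_vec (n : nat) : 'cV[K]_3 := delta_mx (inZp n) 0.

Lemma rank_basis_pair j :
  \rank (row_mx (basis_vec j.+1) (basis_vec j.+2) : 'M_(3, 2)) == 2%N.
Proof.
suff : row_full (row_mx (basis_vec j.+1) (basis_vec j.+2)) by [].
apply/row_fullP; exists (row_mx (basis_vec j.+1) (basis_vec j.+2))^T.
have E i k : ((basis_vec i)^T *m basis_vec k) = (inZp i == inZp k :> 'I_3)%:R%:M.
  apply/matrixP => a b; rewrite !ord1 trmx_delta mul_delta_mx_cond.
  by case: eqP => _; rewrite !mxE.
have ne : (inZp j.+1 == inZp j.+2 :> 'I_3) = false.
  by have := eqn_modDl j.+1 0 1 3; rewrite addn0 addn1 -val_eqE /= => ->.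
rewrite tr_row_mx mul_col_row !E !eqxx ne eq_sym ne /= raddf0.
by rewrite -scalar_mx_block.
Qed.

Lemma vol_basis i z : vol (basis_vec i.+1) (basis_vec i.+2) z = z (inZp i) 0.
Proof.
rewrite volE /basis_vec !mxE /= !andbT -!val_eqE /=.
have -> : i = (i %/ 3 * 3 + i %% 3)%N by rewrite -divn_eq.
have : (i %% 3 < 3)%N by rewrite ltn_mod.
move: (i %/ 3)%N (i %% 3)%N => q r r3; rewrite -!addnS.
have -> : inZp (q * 3 + r) = inZp r :> 'I_3 by apply: val_inj; rewrite /= modnMDl.
rewrite !modnMDl; case: r r3 => [|[|[|//]]] _;
  rewrite !(mul0r, mulr0, mulr1, subr0, sub0r, oppr0, add0r, addr0, mul1r);
  by congr (z _ 0); apply: val_inj.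
Qed.

Lemma vol_inj z z' : (forall u v, vol u v z = vol u v z') -> z = z'.
Proof.
move=> E; apply/colP => j; rewrite -[j]valZpK.
by rewrite -!vol_basis E.
Qed.

Lemma scalar_basis (l : 'cV[K]_3 -> K) v : scalar l ->
  l v = v 0 0 * l (basis_vec 0) + v 1 0 * l (basis_vec 1) + v 2%:R 0 * l (basis_vec 2).
Proof.
move=> lin_l.
have l0 : l 0 = 0.
  have /eqP := lin_l 1 0 0; rewrite scaler0 addr0 mul1r -subr_eq0 opprD.
  by rewrite addrA subrr sub0r oppr_eq0 => /eqP.
rewrite {1}(_ : v = v 0 0 *: basis_vec 0 +
  (v 1 0 *: basis_vec 1 + (v 2%:R 0 *: basis_vec 2 + 0))); last first.
  apply/colP => i; rewrite !mxE !andbT -!val_eqE /=.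
  have [f Ef] : exists f : nat -> K, forall i, v i 0 = f i.
    by exists (fun n => v (inord n) 0) => j; rewrite inord_val.
  rewrite !Ef; case: i => -[|[|[|//]]] /= _; rewrite !(mulr1, mulr0, addr0, add0r) //.
by rewrite !lin_l l0 addr0 addrA.
Qed.

(** The values of F on pairs of distinct basis vectors are determined by three of
them, and these are the coordinates of the vector. *)
Lemma alternating_vol (F : 'cV[K]_3 -> 'cV[K]_3 -> K) :
  (forall u, scalar (F u)) -> (forall u, F u u = 0) -> (forall u v, F v u = - F u v) ->
  forall u v, F u v = vol u v (\col_i F (basis_vec i.+1) (basis_vec i.+2)).
Proof.
move=> linF F0 FN u v.
have bv3 : basis_vec 3 = basis_vec 0 by rewrite /basis_vec; congr delta_mx; apply: val_inj.
have bv4 : basis_vec 4 = basis_vec 1 by rewrite /basis_vec; congr delta_mx; apply: val_inj.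
have FE k : F u (basis_vec k) = - (u 0 0 * F (basis_vec k) (basis_vec 0) +
    u 1 0 * F (basis_vec k) (basis_vec 1) + u 2%:R 0 * F (basis_vec k) (basis_vec 2)).
  by rewrite FN -scalar_basis.
set z := \col_i _.
have z0 : z 0 0 = F (basis_vec 1) (basis_vec 2) by rewrite mxE.
have z1 : z 1 0 = F (basis_vec 2) (basis_vec 0) by rewrite mxE -bv3.
have z2 : z 2%:R 0 = F (basis_vec 0) (basis_vec 1) by rewrite mxE -bv3 -bv4.
rewrite volE z0 z1 z2 (scalar_basis _ (linF u)) !FE !F0.
rewrite [F (basis_vec 1) (basis_vec 0)]FN [F (basis_vec 2) (basis_vec 1)]FN.
rewrite [F (basis_vec 0) (basis_vec 2)]FN.
ring.
Qed.

End Volume.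

(** * Ranks, kernels and left inverses *)

Section MatrixFacts.
Variable K : fieldType.

Lemma mxrank_full_mull m n p (A : 'M[K]_(m, n)) (N : 'M[K]_(n, p)) :
  \rank A == n -> \rank (A *m N) = \rank N.
Proof.
move=> /row_fullP[L LA]; apply/eqP; rewrite eqn_leq mxrankM_maxr /=.
by rewrite -{1}[N]mul1mx -LA -mulmxA mxrankM_maxr.
Qed.

Lemma mxrank_unitr m n (A : 'M[K]_(m, n)) g : g \in unitmx -> \rank (A *m g) = \rank A.
Proof. by move=> ug; rewrite mxrankMfree // row_free_unit. Qed.

Lemma mxrank_ltP m n (A : 'M[K]_(m, n)) :
  (\rank A < n)%N -> exists2 x : 'cV_n, x != 0 & A *m x = 0.
Proof.
move=> rA; have : kermx A^T != 0 by rewrite -mxrank_eq0 mxrank_ker mxrank_tr subn_eq0 -ltnNge.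
move=> /rowV0Pn[x /sub_kermxP xA x0]; exists x^T; last by rewrite -[A]trmxK -trmx_mul xA trmx0.
by apply: contra_neq x0 => /(congr1 trmx); rewrite trmxK trmx0.
Qed.

Lemma rank_of_det m n (L : 'M[K]_(n, m)) (A : 'M[K]_(m, n)) :
  \det (L *m A) != 0 -> \rank A == n.
Proof.
move=> LA; rewrite eqn_leq rank_leq_col /=.
have /mxrank_unit E : L *m A \in unitmx by rewrite unitmxE unitfE.
by have := mxrankM_maxr L A; rewrite E.
Qed.

Lemma det_of_rank m n (A : 'M[K]_(m, n)) :
  \rank A == n -> exists L : 'M_(n, m), \det (L *m A) != 0.
Proof. by move=> /row_fullP[L LA]; exists L; rewrite LA det1 oner_neq0. Qed.

Lemma invmx_mul n (g h : 'M[K]_n) : g \in unitmx -> h \in unitmx ->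
  invmx (g *m h) = invmx h *m invmx g.
Proof.
move=> ug uh; have ugh : g *m h \in unitmx by rewrite unitmx_mul ug.
rewrite -[RHS](mulKmx ugh); have -> : g *m h *m (invmx h *m invmx g) = 1%:M.
  by rewrite mulmxA mulmxK // mulmxV.
by rewrite mulmx1.
Qed.

End MatrixFacts.

(** * Sections of O(1,1) along a fibre of the flag variety *)

Section SectionsOfO11.
Variable R : realType.
Local Notation C := R[i].
Variable s : 'M[C]_(5, 2) -> 'M[C]_(5, 3) -> C.
Hypothesis hs : section_O11 s.

(** The pull-back of the section to the affine line is locally a quotient of
polynomials, hence a polynomial. *)
Lemma section_on_line A0 A1 B : (forall t, flag_frames (A0 + t *: A1, B)) ->
  exists P : {poly C}, forall t, s (A0 + t *: A1) B = P.[t].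
Proof.
move=> flag; have [reg_s _] := hs.
pose phi (t : C^o) : ('M[C]_(5, 2) * 'M[C]_(5, 3))%type := (A0 + t *: A1, B).
have rphi : regmap (setT : set (affine C^o)) phi.
  have algT := regular_alg (setT : set (affine C^o)).
  apply: (coords_in_pair algT); apply: (coords_in_mx algT) => k l; last first.
    exact: (subalgC algT).
  apply: polyfun_regular.
  have -> : (fun t : C^o => (A0 + t *: A1) k l) = (fun t : C^o => A0 k l + t * A1 k l).
    by apply/funext => t; rewrite !mxE.
  have algP := polyfun_alg C^o; apply: (subalgD algP); first exact: (subalgC algP).
  apply: (subalgM algP); last exact: (subalgC algP).
  by apply: polyfun_linear.
suff : regular (setT : set (affine C^o)) (fun t => s (A0 + t *: A1) B).
  move=> reg; apply: locally_rational_univariate => t0.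
  have [p [q [q0 sE]]] := reg t0 I.
  have [P EP] : exists P : {poly C}, peval p =1 horner P.
    by apply: polyfun_univariate; exists p.
  have [Q EQ] : exists Q : {poly C}, peval q =1 horner Q.
    by apply: polyfun_univariate; exists q.
  exists P, Q; rewrite -EQ; split=> // t; rewrite -EP -EQ; exact: sE.
apply: (regular_local (affine_sheafy _)); first exact: openT.
move=> t0 _; have [V [h [oV Vt0 hV sh]]] := reg_s (exist _ (phi t0) (flag t0)) I.
exists (setT `&` phi @^-1` V), (fun t => h (phi t)); split=> //.
- exact: (open_preimage (@openT _ _) rphi oV).
- exact: (regular_comp (@openT _ _) rphi oV hV).
- by move=> t [_ Vt] _; have [_] := sh (exist _ (phi t) (flag t)) Vt.
Qed.

Variable B : 'M[C]_(5, 3).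
Hypothesis rB : \rank B == 3%N.

Lemma flag_framesM (N : 'M[C]_(3, 2)) : \rank N == 2%N -> flag_frames (B *m N, B).
Proof. by move=> rN; split=> //=; [rewrite mxrank_full_mull | exists N]. Qed.

Lemma section_colop (N : 'M[C]_(3, 2)) h : \rank N == 2%N -> h \in unitmx ->
  s (B *m (N *m h)) B = \det h * s (B *m N) B.
Proof.
move=> rN uh; have [_ /(_ _ _ (invmx h) 1%:M (flag_framesM rN))] := hs.
rewrite unitmx_inv uh unitmx1 invmxK invmx1 mulmx1 det_inv invrK det1 invr1 mulr1.
by rewrite mulmxA => ->.
Qed.

(** The section of O(1) on the projective plane of 2-dimensional subspaces of W
that is induced by s, in terms of bases (Bu, Bv); W has basis B. It is extended
by 0 to dependent pairs, where it turns out to be bilinear. *)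
Definition plane_form (u v : 'cV[C]_3) : C :=
  let N : 'M_(3, 2) := row_mx u v in if \rank N == 2%N then s (B *m N) B else 0.

Lemma plane_form_colop (u v u' v' : 'cV[C]_3) (h : 'M[C]_2) : h \in unitmx ->
  row_mx u' v' = row_mx u v *m h -> plane_form u' v' = \det h * plane_form u v.
Proof.
move=> uh E; rewrite /plane_form E mxrank_unitr //; case: ifP => rN.
  exact: section_colop.
by rewrite mulr0.
Qed.

Lemma plane_form_dep (u v : 'cV[C]_3) a b :
  plane_form u (a *: u + b *: v) = b * plane_form u v.
Proof.
have E : row_mx u (a *: u + b *: v) = row_mx u v *m block_mx 1%:M a%:M 0 b%:M.
  by rewrite mul_row_block !mulmx0 !mulmx1 addr0 !mul_mx_scalar.
have [b0|b0] := eqVneq b 0.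
  rewrite b0 mul0r /plane_form scale0r addr0; case: eqP => // rN.
  have : (\rank (row_mx u (a *: u)) <= 1)%N.
    have -> : row_mx u (a *: u) = u *m row_mx 1%:M a%:M.
      by rewrite mul_mx_row mulmx1 mul_mx_scalar.
    exact: leq_trans (mxrankM_maxl _ _) (rank_leq_col _).
  by rewrite rN.
have det_h : \det (block_mx 1%:M a%:M 0 b%:M : 'M[C]_(1 + 1)) = b.
  by rewrite det_ublock det1 det_scalar1 mul1r.
by rewrite (plane_form_colop _ E) ?det_h // unitmxE det_h unitfE.
Qed.

(** Swapping two columns is a product of elementary operations U, L, U and a
sign D. *)
Lemma plane_form_anti (u v : 'cV[C]_3) : plane_form v u = - plane_form u v.
Proof.
pose U : 'M[C]_(1 + 1) := block_mx 1%:M 1%:M 0 1%:M.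
pose L : 'M[C]_(1 + 1) := block_mx 1%:M 0 (- 1%:M) 1%:M.
pose D : 'M[C]_(1 + 1) := block_mx (- 1%:M) 0 0 1%:M.
have E : row_mx v u = row_mx u v *m (U *m L *m U *m D).
  have EU (p q : 'cV[C]_3) : row_mx p q *m U = row_mx p (p + q).
    by rewrite mul_row_block !mulmx1 mulmx0 addr0.
  have EL (p q : 'cV[C]_3) : row_mx p q *m L = row_mx (p - q) q.
    by rewrite mul_row_block mulmxN !mulmx1 mulmx0 add0r.
  have ED (p q : 'cV[C]_3) : row_mx p q *m D = row_mx (- p) q.
    by rewrite mul_row_block mulmxN !mulmx1 !mulmx0 add0r addr0.
  rewrite 3!mulmxA EU EL EU ED.
  by rewrite subrK opprB [u + v]addrC addrK.
have det_h : \det (U *m L *m U *m D) = -1.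
  rewrite !det_mulmx /U /L /D !det_ublock det_lblock !det1 !mul1r.
  by rewrite mulr1 det_mx11 !mxE eqxx mulr1n.
by rewrite (plane_form_colop _ E) ?det_h ?mulN1r // unitmxE det_h unitfE oppr_eq0 oner_neq0.
Qed.

Lemma plane_formZ (u v : 'cV[C]_3) b : plane_form u (b *: v) = b * plane_form u v.
Proof. by have := plane_form_dep u v 0 b; rewrite scale0r add0r. Qed.

Lemma plane_form_diag (u : 'cV[C]_3) : plane_form u u = 0.
Proof. by have := plane_form_dep u u 1 0; rewrite scale0r addr0 scale1r mul0r. Qed.

(** On a line of the projective plane of lines in W the section is a regular
function of degree 1 in homogeneous coordinates, hence affine in each chart. *)
Lemma plane_formD (u v w : 'cV[C]_3) :
  plane_form u (v + w) = plane_form u v + plane_form u w.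
Proof.
(* In the independent case both charts of the line through (u, v) and (u, w) give
   polynomials, related by t |-> 1/t. *)
have [free|] := boolP (\rank (row_mx u (row_mx v w)) == 3%N).
  have line (v' w' : 'cV[C]_3) : (forall t, \rank (row_mx u (v' + t *: w')) == 2%N) ->
      exists P : {poly C}, forall t, plane_form u (v' + t *: w') = P.[t].
    move=> rk; have E t : B *m row_mx u v' + t *: (B *m row_mx (0 : 'cV_3) w') =
        B *m row_mx u (v' + t *: w').
      rewrite scalemxAr -mulmxDr; congr (_ *m _).
      by rewrite scale_row_mx scaler0 add_row_mx addr0.
    have [|P EP] := @section_on_line (B *m row_mx u v') (B *m row_mx (0 : 'cV_3) w') B.
      by move=> t; rewrite E; apply: flag_framesM.
    by exists P => t; rewrite -EP E /plane_form rk.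
  have rk a b : (a != 0) || (b != 0) -> \rank (row_mx u (a *: v + b *: w)) == 2%N.
    move=> ab0; have -> : row_mx u (a *: v + b *: w) =
        row_mx u (row_mx v w) *m block_mx 1%:M 0 0 (col_mx a%:M b%:M).
      by rewrite mul_row_block !mulmx0 mulmx1 addr0 add0r mul_row_col !mul_mx_scalar.
    rewrite mxrank_full_mull // rank_diag_block_mx mxrank1 eqSS.
    rewrite eqn_leq rank_leq_col lt0n mxrank_eq0 /=.
    apply/eqP => c0; move: ab0.
    have := congr1 (fun M : 'M_(1 + 1, 1) => usubmx M 0 0) c0.
    have := congr1 (fun M : 'M_(1 + 1, 1) => dsubmx M 0 0) c0.
    by rewrite !col_mxKu !col_mxKd !mxE eqxx !mulr1n => -> ->; rewrite eqxx.
  have [|P EP] := line v w.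
    by move=> t; have := rk 1 t; rewrite scale1r oner_neq0 => ->.
  have [|Q EQ] := line w v.
    by move=> t; have := rk t 1; rewrite scale1r oner_neq0 orbT addrC => ->.
  have PQ t : t != 0 -> P.[t] = t * Q.[t^-1].
    move=> t0; rewrite -EP -EQ -plane_formZ scalerDr scalerA divff // scale1r.
    by rewrite addrC.
  have := affine_of_reciprocal PQ 1.
  by rewrite -!EP -EQ !scale0r !addr0 scale1r mul1r.
rewrite eqn_leq rank_leq_col /= -ltnNge => /mxrank_ltP[x x0].
have [a [b [c Ex]]] : exists a b c : C, x = col_mx a%:M (col_mx b%:M c%:M).
  exists (usubmx x 0 0), (usubmx (dsubmx x) 0 0), (dsubmx (dsubmx x) 0 0).
  by rewrite -!mx11_scalar !vsubmxK.
rewrite Ex !mul_row_col !mul_mx_scalar => dep.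
have solve k l (p q : 'cV[C]_3) : k != 0 -> a *: u + (l *: p + k *: q) = 0 ->
    plane_form u (p + q) = plane_form u p + plane_form u q.
  move=> k0 E; have -> : q = (- k^-1 * a) *: u + (- k^-1 * l) *: p.
    rewrite -!scalerA -scalerDr; apply: (scalerI k0).
    rewrite scalerA mulrN divff // scaleN1r; apply/esym/eqP.
    by rewrite eq_sym -addr_eq0 addrC -addrA E.
  rewrite addrCA -{1}[p]scale1r -scalerDl !plane_form_dep mulrDl mul1r.
  by [].
have [c0|c0] := eqVneq c 0; last exact: solve dep.
have [b0|b0] := eqVneq b 0; last first.
  by rewrite addrC [RHS]addrC; apply: (solve b c) => //; rewrite [_ *: w + _]addrC.
have u0 : u = 0.
  move: dep; rewrite c0 b0 !scale0r !addr0 => /eqP; rewrite scaler_eq0 => /orP[] /eqP // a0.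
  by move: x0; rewrite Ex a0 b0 c0 raddf0 !col_mx0 eqxx.
have z k : plane_form u k = 0.
  by rewrite plane_form_anti u0 -(scale0r 0) plane_formZ mul0r oppr0.
by rewrite !z addr0.
Qed.

(** This is what makes the definition of qpush by three values independent of
the basis of C^3. *)
Lemma plane_form_vol (u v : 'cV[C]_3) : plane_form u v = vol u v (qpush s B).
Proof.
rewrite (alternating_vol _ plane_form_diag plane_form_anti); last first.
  by move=> p a q r; rewrite plane_formD plane_formZ.
congr vol; apply/colP => j; rewrite !mxE /plane_form rank_basis_pair.
congr (s _ B); rewrite -[in RHS](mulmx1 B) -mulmx_colsub; congr (_ *m _).
apply/matrixP => r c; rewrite !mxE; case: splitP => c' /= Ec; rewrite !mxE ord1 andbT.
  by rewrite Ec ord1 addn0.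
by rewrite Ec ord1 addnS addn0.
Qed.

End SectionsOfO11.

(** The contraction vector of the volume form transforms by g and by the inverse
of det g; the other factor comes from the second argument of s. *)
Lemma qpush_equivariant (R : realType) (s : 'M[R[i]]_(5, 2) -> 'M[R[i]]_(5, 3) -> R[i])
    (B : 'M_(5, 3)) (g : 'M_3) :
  section_O11 s -> \rank B == 3%N -> g \in unitmx ->
  qpush s (B *m invmx g) = (\det g)^-2 *: (g *m qpush s B).
Proof.
move=> hs rB ug; have ugV : invmx g \in unitmx by rewrite unitmx_inv.
have dg : \det g != 0 by rewrite -unitfE -unitmxE.
have rBg : \rank (B *m invmx g) == 3%N by rewrite mxrank_unitr.
have form u v : plane_form s (B *m invmx g) u v =
    (\det g)^-1 * plane_form s B (invmx g *m u) (invmx g *m v).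
  rewrite /plane_form -mul_mx_row mxrank_full_mull ?mxrank_unit //.
  case: ifP => rN; last by rewrite mulr0.
  have [_ /(_ (B *m (invmx g *m row_mx u v)) B 1%:M g)] := hs.
  rewrite unitmx1 ug invmx1 mulmx1 det1 invr1 mul1r mulmxA => -> //.
  rewrite -mulmxA; apply: flag_framesM => //.
  by rewrite mxrank_full_mull // mxrank_unit.
apply: vol_inj => u v; rewrite -plane_form_vol // form plane_form_vol //.
rewrite -[u in RHS](mulKVmx ug) -[v in RHS](mulKVmx ug).
rewrite volZ vol_mulmx mulrA; congr (_ * _).
by rewrite expr2 invfM -mulrA mulVf // mulr1.
Qed.

(** * Matrices with vanishing last column *)

Section Completion.
Variable K : fieldType.

(** GL(n + 1) is transitive on nonzero covectors; only the last standard
covector is needed as a base point. *)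
Lemma row_completion n (w : 'rV[K]_(n + 1)) : w != 0 ->
  exists2 g, g \in unitmx & w = row_mx 0 1%:M *m g.
Proof.
move=> w0; pose U : 'rV[K]_(n + 1) := row_mx 0 1%:M.
have UU : U *m (U^T *m w) = w.
  by rewrite mulmxA tr_row_mx mul_row_col trmx0 trmx1 mul0mx mul1mx add0r mul1mx.
have rw (v : 'rV[K]_(n + 1)) : v != 0 -> \rank v = 1%N.
  by move=> v0; apply/eqP; rewrite eqn_leq rank_leq_row lt0n mxrank_eq0.
have U0 : U != 0.
  by apply: contraNneq w0 => U0; rewrite -UU U0 mul0mx.
have [|g ug Eg] := @complete_unitmx K 1 (n + 1) U (U^T *m w).
  by rewrite UU !rw.
by exists g => //; rewrite -Eg UU.
Qed.

Lemma col_completion n (v : 'cV[K]_(n + 1)) : v != 0 ->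
  exists2 g, g \in unitmx & v = g *m col_mx 0 1%:M.
Proof.
move=> v0; have [|g ug Eg] := @row_completion n v^T.
  by apply: contra_neq v0 => /(congr1 trmx); rewrite trmxK trmx0.
exists g^T; first by rewrite unitmx_tr.
by rewrite -[v]trmxK Eg trmx_mul tr_row_mx trmx0 trmx1.
Qed.

Lemma mulmx_last_col m n (M : 'M[K]_(m, n + 1)) : M *m col_mx 0 1%:M = rsubmx M.
Proof. by rewrite -{1}[M]hsubmxK mul_row_col mulmx0 add0r mulmx1. Qed.

Lemma kill_last_col m n (M : 'M[K]_(m, n + 1)) (v : 'cV_(n + 1)) (g : 'M_(n + 1)) :
  M *m v = 0 -> v = g *m col_mx 0 1%:M -> M *m g = row_mx (lsubmx (M *m g)) (0 : 'M_(m, 1)).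
Proof.
by move=> Mv Ev; rewrite -{1}[M *m g]hsubmxK -(mulmx_last_col (M *m g)) -mulmxA -Ev Mv.
Qed.

End Completion.

(** * Density of matrices of full rank *)

Section PolynomialMatrixFunctions.
Variable R : realType.
Local Notation C := R[i].

Lemma polyfun_entry m n k l : polyfun (fun A : 'M[C]_(m, n) => A k l).
Proof. by apply: polyfun_linear => a u v; rewrite !mxE. Qed.

(** The determinant of the top square block is nonzero only on matrices of full
rank, so the identity principle applies. *)
Lemma full_rank_dense m n (f : 'M[C]_(m, n) -> C) : (n <= m)%N -> polyfun f ->
  (forall A, \rank A == n -> f A = 0) -> forall A, f A = 0.
Proof.
move=> nm pf f0; pose L : 'M[C]_(n, m) := pid_mx n.
have algP := polyfun_alg 'M[C]_(m, n).
apply: (@polyfun_dense R _ f (fun A => \det (L *m A)) (pid_mx n)) => //.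
- apply: (subalg_det algP) => k l; apply: (subalg_mulmx algP) => j.
    exact: (subalgC algP).
  exact: polyfun_entry.
- by rewrite mul_pid_mx !minnn (minn_idPr nm) pid_mx_1 det1 oner_neq0.
- by move=> A /rank_of_det; apply: f0.
Qed.

End PolynomialMatrixFunctions.

(** * The equivariant polynomial map of a section *)

Section EquivariantExtension.
Variable R : realType.
Local Notation C := R[i].
Variables (s : 'M[C]_(5, 2) -> 'M[C]_(5, 3) -> C) (shat : 'M[C]_(5, 3) -> 'cV[C]_3).
Hypothesis hs : section_O11 s.
Hypothesis shat_poly : forall j, polyfun (fun B => shat B j 0).
Hypothesis hshat : forall B, \rank B == 3%N -> shat B = qpush s B.

(** Both sides are polynomial in B and agree on matrices of rank 3. *)
Lemma shat_equivariant (B : 'M_(5, 3)) (g : 'M_3) : g \in unitmx ->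
  shat (B *m invmx g) = (\det g)^-2 *: (g *m shat B).
Proof.
move=> ug; apply/colP => j; apply/eqP; rewrite -subr_eq0; apply/eqP; move: B.
have algP := polyfun_alg 'M[C]_(5, 3).
apply: full_rank_dense => // [|B rB]; last first.
  rewrite hshat ?mxrank_unitr ?unitmx_inv // hshat //.
  by rewrite (qpush_equivariant hs rB ug) subrr.
apply: (subalgB algP).
  apply: (coords_in_polyfun algP (phi := fun B : 'M_(5, 3) => B *m invmx g)
    _ (shat_poly j)).
  apply: (coords_in_mx algP) => k l; apply: (subalg_mulmx algP) => i.
    exact: polyfun_entry.
  exact: (subalgC algP).
under eq_fun do [rewrite mxE].
apply: (subalgM algP); first exact: (subalgC algP).
by apply: (subalg_mulmx algP) => k; [apply: (subalgC algP) | apply: shat_poly].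
Qed.

(** The same identity without an inverse matrix. *)
Lemma shat_mulmx (B : 'M_(5, 3)) (h : 'M_3) : h \in unitmx ->
  h *m shat (B *m h) = \det h ^+ 2 *: shat B.
Proof.
move=> uh; have := @shat_equivariant B (invmx h); rewrite unitmx_inv invmxK => -> //.
by rewrite det_inv exprVn invrK -scalemxAr mulKVmx.
Qed.

(** The diagonal matrix with entries 1, 1, x shows that the components of shat
are homogeneous of degree 2, 2 and 1 in the last column. *)
Lemma shat_scale_last (A : 'M_(5, 2)) (w : 'cV_5) x :
  let sh := fun x => shat (row_mx A (x *: w)) : 'cV_(2 + 1) in
  usubmx (sh x) = x ^+ 2 *: usubmx (sh 1) /\ dsubmx (sh x) = x *: dsubmx (sh 1).
Proof.
move=> sh.
have sh_x y : y != 0 ->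
    usubmx (sh y) = y ^+ 2 *: usubmx (sh 1) /\ dsubmx (sh y) = y *: dsubmx (sh 1).
  move=> y0; pose h : 'M[C]_(2 + 1) := block_mx 1%:M 0 0 y%:M.
  have dh : \det h = y by rewrite det_ublock det1 det_scalar1 mul1r.
  have uh : h \in unitmx by rewrite unitmxE dh unitfE.
  have := @shat_mulmx (row_mx A w) h uh.
  have -> : (row_mx A w *m h : 'M_(5, 2 + 1)) = row_mx A (y *: w).
    by rewrite mul_row_block !mulmx0 mulmx1 mul_mx_scalar addr0 add0r.
  rewrite dh => E.
  have E' : h *m col_mx (usubmx (sh y)) (dsubmx (sh y)) =
      y ^+ 2 *: col_mx (usubmx (sh 1)) (dsubmx (sh 1)).
    by rewrite !vsubmxK /sh scale1r.
  move: E'; rewrite mul_block_col !mul0mx mul1mx addr0 add0r scale_col_mx.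
  move=> /eq_col_mx[-> E1]; split=> //; apply: (scalerI y0).
  by move: E1; rewrite mul_scalar_mx scalerA.
have cont j c e : (forall y, y != 0 -> sh y j 0 = y ^+ e * c) -> sh x j 0 = x ^+ e * c.
  move=> Ec.
  have [P EP] := polyfun_line (row_mx A 0) (row_mx (0 : 'M_(5, 2)) w) (shat_poly j).
  have {}EP y : sh y j 0 = P.[y].
    by rewrite -EP /sh scale_row_mx add_row_mx scaler0 addr0 add0r.
  suff PX : P = c *: 'X^e.
    by rewrite EP PX hornerZ hornerXn mulrC.
  have X0 : 'X != 0 :> {poly C} by rewrite polyX_eq0.
  apply: (mulfI X0); apply: poly_fun_inj => y.
  rewrite !hornerM hornerX; have [->|y0] := eqVneq y 0; first by rewrite !mul0r.
  by rewrite -EP Ec // hornerZ hornerXn [c * _]mulrC.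
split; apply/colP => j; rewrite !mxE.
  apply: (cont (lshift 1 j)) => y y0; have [/colP/(_ j)] := sh_x y y0.
  by rewrite !mxE.
apply: (cont (rshift 2 j) _ 1%N) => y y0; have [_ /colP/(_ j)] := sh_x y y0.
by rewrite !mxE expr1.
Qed.

Lemma shat_last0 (A : 'M_(5, 2)) : shat (row_mx A 0) = 0.
Proof.
have [E1 E2] := shat_scale_last A 0 0; rewrite scaler0 in E1 E2.
have -> : shat (row_mx A 0) = col_mx (usubmx (shat (row_mx A 0) : 'cV_(2 + 1)))
    (dsubmx (shat (row_mx A 0) : 'cV_(2 + 1))) by rewrite vsubmxK.
by rewrite E1 E2 expr0n !scale0r col_mx0.
Qed.

(** Move a kernel vector of B to the last basis vector. *)
Lemma shat_degenerate (B : 'M_(5, 3)) : (\rank B < 3)%N -> shat B = 0.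
Proof.
move=> /mxrank_ltP[v v0 Bv]; have [g ug Ev] := @col_completion _ 2 v v0.
have := @shat_mulmx B g ug; rewrite (@kill_last_col _ 5 2 B v g Bv Ev) shat_last0 mulmx0.
move=> /esym/eqP; rewrite scaler_eq0 expf_eq0 /= => /orP[/eqP dg|/eqP //].
by move: ug; rewrite unitmxE dg unitr0.
Qed.

(** The value s (A, (A | e_j)) is at the same time a component of p_* s at A and
the last component of q_* s at (A | e_j). If (A | e_j) has rank at most 2, the
former is 0 by definition, and the latter because shat vanishes there. *)
Lemma shat_ppush (A : 'M_(5, 2)) j :
  dsubmx (shat (row_mx A (delta_mx j 0 : 'cV_5)) : 'cV_(2 + 1)) 0 0 = ppush s A j 0.
Proof.
rewrite mxE [RHS]mxE /=.
case: ifPn => rA'; last first.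
  rewrite shat_degenerate ?mxE // ltn_neqAle rA'.
  exact: (rank_leq_col (row_mx A (delta_mx j 0 : 'cV_5))).
rewrite hshat // mxE; congr (s _ _).
apply/matrixP => k l; rewrite mxE.
have -> : inZp (@rshift 2 1 0 + l).+1 = lshift 1 l by apply: val_inj; case: l => -[|[|//]] /=.
exact: row_mxEl.
Qed.

End EquivariantExtension.

(** * The numerical criterion, in both directions *)

Section Stability.
Variable R : realType.
Local Notation C := R[i].

(** A polynomial curve through the orbit in C * vT that reaches 0 * vT at t = 0
puts its limit in the Zariski closure. *)
Lemma destabilize n (vT : vectType C) (act : 'M[C]_n -> vT -> vT) (chi : 'M[C]_n -> C)
    (v : vT) (c : C^o -> C) (gamma : C^o -> vT) :
  polyfun c -> coords_in (@polyfun R C^o) gamma -> c 0 = 0 ->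
  (forall t, t != 0 -> exists2 g, g \in unitmx & (c t = (chi g)^-1) /\ gamma t = act g v) ->
  ~ semistable act chi v.
Proof.
move=> pc pgamma c0 orbit /(_ (gamma 0)); apply=> p p0.
have algP := polyfun_alg C^o.
have pc' : coords_in (@polyfun R C^o) (c : C^o -> C^o).
  move=> k; have -> : (fun t => coord (vbasis {: C^o}) k (c t : C^o)) =
      fun t => c t * coord (vbasis {: C^o}) k 1.
    by apply/funext => t; rewrite -linearZ /= [c t *: _]mulr1.
  by apply: (subalgM algP) => //; apply: (subalgC algP).
have pf : polyfun (fun t : C^o => peval p (c t, gamma t)).
  by apply: (coords_in_polyfun algP (coords_in_pair algP pc' pgamma)); exists p.
have pid : polyfun (fun t : C^o => t : C) by apply: polyfun_linear.
rewrite -[X in (X, _)]c0.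
apply: (polyfun_dense (a := 1 : C^o) pf pid (oner_neq0 _) _ 0) => t t0.
 have [g ug [-> ->]] := orbit t t0; apply: p0.
by exists g.
Qed.

(** The function z * f x - f v vanishes on the orbit of (1, v) but nowhere on
0 * vT. *)
Lemma semistable_semiinvariant n (vT : vectType C) (act : 'M[C]_n -> vT -> vT)
    (chi : 'M[C]_n -> C) (v : vT) (f : vT -> C) :
  polyfun f -> f v != 0 ->
  (forall g, g \in unitmx -> chi g != 0 /\ f (act g v) = chi g * f v) ->
  semistable act chi v.
Proof.
move=> pf fv fact u cl.
have algP := polyfun_alg (C^o * vT)%type.
have [p Ep] : polyfun (fun x : (C^o * vT)%type => x.1 * f x.2 - f v).
  apply: (subalgB algP); last exact: (subalgC algP).
  apply: (subalgM algP); first exact: polyfun_linear.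
  apply: (coords_in_polyfun algP (phi := fun x : (C^o * vT)%type => x.2)) => // i.
  by apply: polyfun_linear => a x y; rewrite linearP.
have : peval p ((0, u) : (C^o * vT)%type) = 0.
  apply: cl => _ [g ug ->]; have [chi0 fg] := fact g ug.
  by rewrite -Ep /= fg mulrA mulVf // mul1r subrr.
by rewrite -Ep /= mul0r sub0r => /eqP; rewrite oppr_eq0 (negPf fv).
Qed.

End Stability.

(** * Semistable points of the model *)

Section ModelStability.
Variable R : realType.
Local Notation C := R[i].
Local Notation act := (@model_act R).

Lemma rho_neq0 tau (g : 'M[C]_3) : g \in unitmx -> rho tau g != 0.
Proof. by move=> ug; rewrite /rho expfz_neq0 // -unitfE -unitmxE. Qed.

Lemma coords_in_model (T : Type) (P : (T -> C) -> Prop) (B : T -> 'M[C]_(5, 3))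
    (w : T -> 'rV[C]_3) : subalgebra P ->
  (forall k l, P (fun x => B x k l)) -> (forall l, P (fun x => w x 0 l)) ->
  coords_in P (fun x => (B x, w x) : model R).
Proof.
move=> algP PB Pw; apply: (coords_in_pair algP); apply: (coords_in_mx algP) => //.
by move=> k l; rewrite ord1.
Qed.

Lemma polyfun_model1 k l : polyfun (fun x : model R => x.1 k l).
Proof. by apply: polyfun_linear => a u v; rewrite !mxE. Qed.

Lemma polyfun_model2 k l : polyfun (fun x : model R => x.2 k l).
Proof. by apply: polyfun_linear => a u v; rewrite !mxE. Qed.

Lemma act_invmx (h : 'M[C]_3) (B : 'M_(5, 3)) (w : 'rV_3) : h \in unitmx ->
  act (invmx h) (B, w) = (B *m h, (\det h)^-2 *: (w *m h)).
Proof. by move=> uh; rewrite /model_act /= invmxK det_inv exprVn. Qed.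

(** Along h(t)^-1 the point has a limit at t = 0, and the inverse of the
character tends to 0. *)
Lemma destabilize_model (tau : int) (h : C -> 'M[C]_3) (B B1 : 'M[C]_(5, 3))
    (w M1 M2 : 'rV[C]_3) (N e i j : nat) :
  (forall t, t != 0 -> [/\ h t \in unitmx, \det (h t) ^ (- tau) = t ^+ N.+1,
     B *m h t = t ^+ e *: B1 &
     w *m h t = \det (h t) ^+ 2 *: (t ^+ i *: M1 + t ^+ j *: M2)]) ->
  ~ semistable act (rho tau) (B, w).
Proof.
move=> hP; have algP := polyfun_alg C^o.
have pX n : polyfun (fun t : C^o => (t : C) ^+ n).
  by apply: (subalgX algP); apply: polyfun_linear.
refine (destabilize (c := fun t : C^o => (t : C) ^+ N.+1)
  (gamma := fun t : C^o => (t ^+ e *: B1, t ^+ i *: M1 + t ^+ j *: M2)) _ _ _ _).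
- exact: pX.
- apply: (coords_in_model algP) => [k l|l].
    under eq_fun do [rewrite mxE].
    by apply: (subalgM algP) => //; apply: (subalgC algP).
  under eq_fun do [rewrite 3!mxE].
  by apply: (subalgD algP); apply: (subalgM algP) => //; apply: (subalgC algP).
- by rewrite expr0n.
- move=> t t0; have [uh dh Bh wh] := hP t t0.
  have dh0 : \det (h t) != 0 by rewrite -unitfE -unitmxE.
  exists (invmx (h t)); first by rewrite unitmx_inv.
  rewrite act_invmx // Bh wh scalerA mulVf ?expf_neq0 // scale1r; split=> //.
  by rewrite /rho det_inv exprz_inv opprK invr_expz -dh.
Qed.

(** If v is a kernel vector of B, then diag (1, 1, 1/t) in a basis ending with v is
the inverse of a subgroup that fixes B and contracts omega. If L is a left inverse
of B, the power det (L B) ^ tau is a semi-invariant that does not vanish at B. *)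
Lemma semistable_pos (tau : int) (x : model R) : 0 < tau ->
  semistable act (rho tau) x <-> \rank x.1 == 3%N.
Proof.
case: x => B w; case: tau => // -[//|n] _ /=; split=> [|rB].
  apply: contraPT => rB; have {}rB : (\rank B < 3)%N.
    by rewrite ltn_neqAle rB rank_leq_col.
  have [v v0 Bv] := mxrank_ltP rB; have [q uq Ev] := @col_completion _ 2 v v0.
  have dq : \det q != 0 by rewrite -unitfE -unitmxE.
  have Bq := @kill_last_col _ 5 2 B v q Bv Ev.
  pose a := lsubmx (w *m q : 'rV_(2 + 1)); pose b := rsubmx (w *m q : 'rV_(2 + 1)).
  have wq : w *m q = row_mx a b by rewrite hsubmxK.
  pose D (t : C) : 'M[C]_(2 + 1) := block_mx 1%:M 0 0 t^-1%:M.
  have dD t : \det (D t) = t^-1 by rewrite det_ublock det1 det_scalar1 mul1r.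
  apply: (@destabilize_model n.+1 (fun t => q *m D t *m invmx q) B B w
    (row_mx a 0 *m invmx q) (row_mx 0 b *m invmx q) n 0 2 1) => t t0.
  have dh : \det (q *m D t *m invmx q) = t^-1.
    by rewrite !det_mulmx det_inv mulrAC divff // mul1r dD.
  split.
  + by rewrite unitmxE dh unitfE invr_eq0.
  + by rewrite dh -exprz_inv invrK.
  + rewrite scale1r !mulmxA Bq mul_row_block !mulmx0 mul0mx mulmx1 !addr0 -Bq.
    by rewrite mulmxK.
  + rewrite dh !mulmxA wq mul_row_block !mulmx0 mulmx1 addr0 add0r mul_mx_scalar.
    rewrite scalerDr !scalerA -exprMn mulVf // expr1n scale1r.
    rewrite expr2 expr1 -mulrA mulVf // mulr1.
    by rewrite scalemxAl -mulmxDl scale_row_mx add_row_mx scaler0 addr0 add0r.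
have [L dL] := det_of_rank rB; have algP := polyfun_alg (model R).
apply: (semistable_semiinvariant (f := fun x : model R => \det (L *m x.1) ^+ n.+1)).
- apply: (subalgX algP); apply: (subalg_det algP) => k l.
  apply: (subalg_mulmx algP) => m; first exact: (subalgC algP).
  exact: polyfun_model1.
- by rewrite expf_neq0.
- move=> g ug; split; first exact: rho_neq0.
  by rewrite /= mulmxA det_mulmx det_inv exprMn mulrC exprVn.
Qed.

(** In coordinates where omega is the last covector, the first two columns of B
span the image of the kernel of omega. *)
Lemma covector_frame (B : 'M[C]_(5, 3)) (w : 'rV[C]_3) : w != 0 ->
  exists (A : 'M_(5, 2)) (b : 'cV_5) (g : 'M_3), [/\ g \in unitmx,
    B = (row_mx A b : 'M_(5, 2 + 1)) *m g, w = (row_mx 0 1%:M : 'rV_(2 + 1)) *m g &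
    \rank (col_mx B w) = (\rank A + 1)%N].
Proof.
move=> w0; have [g ug Ew] := @row_completion _ 2 w w0.
pose Bg : 'M_(5, 2 + 1) := B *m invmx g.
exists (lsubmx Bg), (rsubmx Bg), g.
have EB : B = row_mx (lsubmx Bg) (rsubmx Bg) *m g by rewrite hsubmxK mulmxKV.
split=> //; rewrite {1}EB {1}Ew -mul_col_mx mxrank_unitr //.
have -> : col_mx (row_mx (lsubmx Bg) (rsubmx Bg)) (row_mx 0 1%:M) =
    block_mx 1%:M (rsubmx Bg) 0 1%:M *m block_mx (lsubmx Bg) 0 0 1%:M.
  by rewrite mulmx_block !mul1mx !mulmx0 !mul0mx !mulmx1 !addr0 !add0r.
rewrite mxrank_full_mull.
  by have := rank_diag_block_mx (lsubmx Bg) (1%:M : 'M[C]_1); rewrite mxrank1.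
apply/eqP/mxrank_unit.
by rewrite unitmxE det_ublock !det1 mulr1 unitr1.
Qed.

(** A common kernel vector of B and omega leads to the inverse subgroup
diag (t^2, t^2, t^-3), of determinant t, which fixes omega because of the factor
det^2 and contracts B; scalars destabilize omega = 0. Otherwise B is injective on
the kernel of omega, and omega together with two combinations of the rows of B has
a nonzero determinant, which is semi-invariant of weight det. *)
Lemma semistable_neg (tau : int) (x : model R) : tau < 0 ->
  semistable act (rho tau) x <-> x.2 != 0 /\ \rank (col_mx x.1 x.2) == 3%N.
Proof.
case: x => B w; case: tau => // n _ /=; split=> [ss|[w0 rM]].
  split.
    apply: contraPneq ss => ->.
    apply: (@destabilize_model (Negz n) (fun t => t%:M) B B 0 0 0 (3 * n.+1).-1 1 0 0) => t t0.
    split; rewrite ?det_scalar.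
    + by rewrite unitmxE det_scalar unitfE expf_neq0.
    + by rewrite NegzE opprK prednK // exprM.
    + by rewrite mul_mx_scalar expr1.
    + by rewrite mul0mx !scaler0 addr0 scaler0.
  apply: contraPT ss => rM; have {}rM : (\rank (col_mx B w) < 3)%N.
    by rewrite ltn_neqAle rM rank_leq_col.
  have [v v0 Mv] := mxrank_ltP rM; have [q uq Ev] := @col_completion _ 2 v v0.
  have [Bv wv] : B *m v = 0 /\ w *m v = 0.
    by move: Mv; rewrite mul_col_mx -(@col_mx0 _ 5 1 1) => /eq_col_mx.
  have dq : \det q != 0 by rewrite -unitfE -unitmxE.
  have Bq := @kill_last_col _ 5 2 B v q Bv Ev.
  have wq := @kill_last_col _ 1 2 w v q wv Ev.
  pose D (t : C) : 'M[C]_(2 + 1) := block_mx (t ^+ 2)%:M 0 0 (t ^- 3)%:M.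
  have dD t : t != 0 -> \det (D t) = t.
    move=> t0; rewrite det_ublock !det_scalar -exprM expr1.
    by rewrite (_ : (2 * 2 = 1 + 3)%N) // exprD expr1 -mulrA divff ?mulr1 // expf_neq0.
  apply: (@destabilize_model (Negz n) (fun t => q *m D t *m invmx q)
    B B w w 0 n 2 0 0) => t t0.
  have dh : \det (q *m D t *m invmx q) = t.
    by rewrite !det_mulmx det_inv mulrAC divff // mul1r dD.
  split.
  + by rewrite unitmxE dh unitfE.
  + by rewrite dh NegzE opprK.
  + rewrite !mulmxA Bq mul_row_block !mulmx0 mul0mx !addr0 mul_mx_scalar.
    rewrite -[X in row_mx _ X](scaler0 _ (t ^+ 2)) -scale_row_mx -Bq.
    by rewrite -scalemxAl mulmxK.
  + rewrite dh !mulmxA wq mul_row_block !mulmx0 mul0mx !addr0 mul_mx_scalar.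
    rewrite -[X in row_mx _ X](scaler0 _ (t ^+ 2)) -scale_row_mx -wq.
    by rewrite -scalemxAl mulmxK // scaler0 addr0 scale1r.
have [A [b [g [ug EB Ew rA]]]] := covector_frame B w0.
have {rA} /row_fullP[L LA] : row_full A.
  by move: rM; rewrite rA addn1 eqSS.
have dg : \det g != 0 by rewrite -unitfE -unitmxE.
pose f (x : model R) := \det (col_mx (L *m x.1) x.2 : 'M_(2 + 1)).
have f0 : f (B, w) != 0.
  rewrite /f /= EB Ew mulmxA -mul_col_mx mul_mx_row LA det_mulmx mulf_neq0 //.
  by rewrite -/(block_mx 1%:M _ 0 1%:M) det_ublock !det1 mulr1 oner_neq0.
have algP := polyfun_alg (model R).
apply: (semistable_semiinvariant (f := fun x : model R => f x ^+ n.+1)).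
- apply: (subalgX algP); apply: (subalg_det algP) => k l.
  under eq_fun do [rewrite mxE].
  case: (split k) => k'; last exact: polyfun_model2.
  apply: (subalg_mulmx algP) => m; first exact: (subalgC algP).
  exact: polyfun_model1.
- by rewrite expf_neq0.
- move=> h uh; split; first exact: rho_neq0.
  have dh : \det h != 0 by rewrite -unitfE -unitmxE.
  rewrite /rho NegzE opprK -exprMn; congr (_ ^+ _); rewrite /f /=.
  have -> : col_mx (L *m (B *m invmx h)) (\det h ^+ 2 *: (w *m invmx h)) =
      block_mx 1%:M 0 0 (\det h ^+ 2)%:M *m (col_mx (L *m B) w *m invmx h).
    by rewrite mul_col_mx mul_block_col !mul0mx addr0 add0r mul1mx mul_scalar_mx mulmxA.
  rewrite !det_mulmx det_ublock det1 mul1r det_scalar1 det_inv.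
  by move: (\det h) (\det _) dh => d e d0; field.
Qed.

End ModelStability.

(** * The superpotential and its symmetry *)

Section Superpotential.
Variable R : realType.
Local Notation C := R[i].
Local Notation act := (@model_act R).
Variable shat : 'M[C]_(5, 3) -> 'cV[C]_3.
Hypothesis shat_poly : forall j, polyfun (fun B => shat B j 0).
Local Notation W := (superpotential shat).

Lemma polyfun_superpotential : polyfun W.
Proof.
have algP := polyfun_alg (model R); apply: (subalg_mulmx algP) => k.
  exact: polyfun_model2.
apply: (coords_in_polyfun algP (phi := fun x : model R => x.1) _ (shat_poly k)).
by apply: (coords_in_mx algP) => i j; apply: polyfun_model1.
Qed.

Lemma model_act_comp (g h : 'M[C]_3) (x : model R) : g \in unitmx -> h \in unitmx ->
  act (g *m h) x = act g (act h x).
Proof.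
move=> ug uh; rewrite /model_act /= det_mulmx -scalemxAl !scalerA -exprMn.
by rewrite invmx_mul // !mulmxA.
Qed.

Lemma model_act_linear (g : 'M[C]_3) : linear (act g).
Proof.
move=> a x y; rewrite /model_act; congr pair => /=.
  by rewrite mulmxDl -scalemxAl.
by rewrite mulmxDl -scalemxAl scalerDr !scalerA mulrC.
Qed.

(** On GL(3) the inverse is the adjugate divided by the determinant. *)
Lemma model_act_regular k : regular
  (s := subspace (X := affine ('M[C]_3 * model R)%type) [set x | x.1 \in unitmx]) setT
  (fun x => coord (vbasis {: model R}) k (act (sval x).1 (sval x).2)).
Proof.
move=> x _; set T := affine _ in x *.
have lin1 i j : polyfun (fun y : ('M[C]_3 * model R)%type => y.1 i j).
  by apply: polyfun_linear => a u v; rewrite !mxE.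
pose D : set T := [set y | \det y.1 != 0].
have pdet : polyfun (fun y : ('M[C]_3 * model R)%type => \det y.1).
  by apply: (subalg_det (polyfun_alg _)).
have algD := regular_alg D.
have rdet : regular D (fun y => (\det y.1)^-1).
  by apply: regular_inv => //; exact: (polyfun_regular pdet).
have rinv i j : regular D (fun y => ((\det y.1)^-1 *: \adj y.1) i j).
  under eq_fun do [rewrite mxE].
  apply: (subalgM algD) => //; apply: (subalg_adj algD) => i' j'.
  exact: (polyfun_regular (lin1 i' j')).
exists D, (fun y => coord (vbasis {: model R}) k
  (y.2.1 *m ((\det y.1)^-1 *: \adj y.1),
   \det y.1 ^+ 2 *: (y.2.2 *m ((\det y.1)^-1 *: \adj y.1)))).
split.
- exact: (open_polyfun pdet).
- by case: x => y /=; rewrite unitmxE unitfE.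
- move: k; apply: (coords_in_model algD) => [i j|j].
    apply: (subalg_mulmx algD) => l //; apply: polyfun_regular.
    by apply: polyfun_linear => a u v; rewrite !mxE.
  under eq_fun do [rewrite mxE].
  apply: (subalgM algD); first by apply: (subalgX algD); apply: polyfun_regular.
  apply: (subalg_mulmx algD) => l //; apply: polyfun_regular.
  by apply: polyfun_linear => a u v; rewrite !mxE.
- move=> y _; split; first by [].
  have invE : invmx (sval y).1 = (\det (sval y).1)^-1 *: \adj (sval y).1.
    by rewrite /invmx (svalP y).
  by rewrite /model_act invE.
Qed.

Hypothesis shat_equiv : forall (B : 'M_(5, 3)) (g : 'M_3), g \in unitmx ->
  shat (B *m invmx g) = (\det g)^-2 *: (g *m shat B).

Lemma superpotential_invariant g x : g \in unitmx -> W (act g x) = W x.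
Proof.
move=> ug; have dg : \det g != 0 by rewrite -unitfE -unitmxE.
rewrite /superpotential /= shat_equiv // -scalemxAl -scalemxAr scalerA.
by rewrite divff ?expf_neq0 // scale1r -mulmxA mulKmx.
Qed.

Lemma glsm_model : glsm act W.
Proof.
split.
- split=> [[B w]|g h x ug uh]; last exact: model_act_comp.
  by rewrite /model_act /= invmx1 det1 expr1n scale1r !mulmx1.
- by move=> g _; apply: model_act_linear.
- exact: model_act_regular.
- exact: polyfun_superpotential.
- by move=> g v; apply: superpotential_invariant.
Qed.

Lemma model_actK g x : g \in unitmx -> act g (act (invmx g) x) = x.
Proof.
move=> ug; rewrite -model_act_comp ?unitmx_inv // mulmxV //.
by case: glsm_model => -[-> _].
Qed.

Lemma crit_act g x : g \in unitmx -> crit W x -> crit W (act g x).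
Proof.
move=> ug /(critP _ polyfun_superpotential) cx.
apply/(critP _ polyfun_superpotential) => u.
have [P EP P1] := cx (act (invmx g) u); exists P => // t.
rewrite -EP -[RHS](superpotential_invariant _ ug); congr (W _).
have lin := model_act_linear g.
by rewrite addrC [in RHS]addrC lin model_actK.
Qed.

(** These are the derivatives in the direction of omega. *)
Lemma crit_shat0 x : crit W x -> shat x.1 = 0.
Proof.
move=> /(critP _ polyfun_superpotential) cx; apply/colP => j; rewrite mxE.
have [P EP P1] := cx (0, delta_mx 0 j).
have EP' : P = ((x.2 *m shat x.1) 0 0)%:P + shat x.1 j 0 *: 'X.
  apply: poly_fun_inj => t; rewrite -EP !hornerE /superpotential /= scaler0 addr0.
  by rewrite mulmxDl mxE -scalemxAl [X in _ + X]mxE -rowE !mxE mulrC.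
by move: P1; rewrite EP' coefD coefC coefZ coefX mulr1 add0r.
Qed.

End Superpotential.

(** * Critical points of the superpotential *)

Section CriticalLocus.
Variable R : realType.
Local Notation C := R[i].
Local Notation act := (@model_act R).

(** The derivative of f at v along u exists and is 0. *)
Definition flat_along (vT : vectType C) (f : vT -> C) (v u : vT) :=
  exists2 P : {poly C}, forall t, f (v + t *: u) = P.[t] & P`_1 = 0.

Lemma flat_along_comb (vT : vectType C) (f : vT -> C) (v u u' : vT) a :
  polyfun f -> flat_along f v u -> flat_along f v u' -> flat_along f v (a *: u + u').
Proof.
move=> [p Ep] [Q EQ Q1] [Q' EQ' Q'1].
have uniq_flat (w : vT) (P P' : {poly C}) : (forall t, f (v + t *: w) = P.[t]) ->
    (forall t, peval p (v + t *: w) = P'.[t]) -> P' = P.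
  by move=> EP EP'; apply: poly_fun_inj => t; rewrite -EP' -EP Ep.
have [P EP P1] := directional_derivative p v (a *: u + u').
exists P => [t|]; first by rewrite Ep EP.
have [K EK K1] := directional_derivative p v u.
have [K' EK' K'1] := directional_derivative p v u'.
rewrite P1 (eq_bigr (fun i => a * (coord (vbasis {:vT}) i u * peval p^`M(i) v) +
  coord (vbasis {:vT}) i u' * peval p^`M(i) v)); last first.
  by move=> i _; rewrite linearP /= mulrDl mulrA.
rewrite big_split -mulr_sumr -K1 -K'1 (uniq_flat u Q K EQ EK) (uniq_flat u' Q' K' EQ' EK').
by rewrite Q1 Q'1 mulr0; apply: addr0.
Qed.

Variables (s : 'M[C]_(5, 2) -> 'M[C]_(5, 3) -> C) (shat : 'M[C]_(5, 3) -> 'cV[C]_3).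
Hypothesis hs : section_O11 s.
Hypothesis shat_poly : forall j, polyfun (fun B => shat B j 0).
Hypothesis hshat : forall B, \rank B == 3%N -> shat B = qpush s B.
Local Notation W := (superpotential shat).

Let polyW : polyfun W := polyfun_superpotential shat_poly.

(** Criticality says that omega annihilates the image of the differential of
shat at B; this image is everything when the zero scheme is smooth of
codimension 3. *)
Lemma crit_smooth (B : 'M_(5, 3)) w : smooth_zero_scheme (qpush s) ->
  \rank B == 3%N -> crit W (B, w) -> w = 0.
Proof.
move=> [p ext smooth] rB cBw; have sh0 : shat B = 0 := crit_shat0 shat_poly cBw.
have J3 := smooth B rB; rewrite -hshat // in J3; have {}J3 := J3 sh0.
set J := \matrix_(i, j) _ in J3.
have pE k A : peval (p k) A = shat A k 0.
  apply/eqP; rewrite -subr_eq0; apply/eqP; move: A.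
  apply: full_rank_dense => // [|A rA]; last by rewrite hshat // (ext A rA) subrr.
  by apply: (subalgB (polyfun_alg _)) => //; exists (p k).
have freeJ : row_free J by rewrite /row_free J3.
suff /eqP : w *m J = 0 by rewrite mulmx_free_eq0 // => /eqP.
apply/rowP => j; rewrite !mxE.
have [P EP P1] := (critP (B, w) polyW).1 cBw ((vbasis {: 'M[C]_(5, 3)})`_j, 0).
have /all_sig2[Q EQ Q1] k :=
  cid2 (directional_derivative (p k) B (vbasis {: 'M[C]_(5, 3)})`_j).
have PQ : P = \sum_(k < 3) w 0 k *: Q k.
  apply: poly_fun_inj => t; rewrite -EP horner_sum.
  under [RHS]eq_bigr => k _ do rewrite hornerZ -EQ pE.
  by rewrite /superpotential /= scaler0 addr0 mxE.
rewrite -[RHS]P1 PQ coef_sum; apply: eq_bigr => k _; rewrite coefZ Q1 mxE; congr (_ * _).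
rewrite (bigD1 j) //= big1 ?addr0 => [|l lj].
  by rewrite coord_free ?eqxx ?mul1r // (basis_free (vbasisP _)).
by rewrite coord_free ?(basis_free (vbasisP _)) // eq_sym (negPf lj) mul0r.
Qed.

(** The superpotential is a sum of products of a component of omega and one of
shat, all of which vanish at the point. *)
Lemma crit_zero_covector (B : 'M_(5, 3)) : shat B = 0 -> crit W (B, 0).
Proof.
move=> sh0; apply/(critP _ polyW) => -[b w].
have flat_b : flat_along W (B, 0) (b, 0).
  by exists 0 => [t|]; rewrite ?coef0 // horner0 /superpotential /= scaler0 addr0 mul0mx mxE.
have flat_w : flat_along W (B, 0) (0, w).
  exists 0 => [t|]; rewrite ?coef0 // horner0 /superpotential /= scaler0 addr0 sh0.
  by rewrite mulmx0 mxE.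
have := flat_along_comb 1 polyW flat_b flat_w; congr (flat_along W _ _).
by rewrite scale1r; congr pair; rewrite /= ?addr0 ?add0r.
Qed.

(** The normal form of a semistable critical point in the negative phase: A is a
basis of the image of B, and omega is a coordinate on the kernel. *)
Definition neg_embedding (A : 'M[C]_(5, 2)) : model R :=
  (row_mx A 0 : 'M_(5, 2 + 1), row_mx 0 1%:M : 'rV_(2 + 1)).

Lemma superpotential_last (A : 'M_(5, 2)) (b : 'cV_5) :
  W ((row_mx A b : 'M_(5, 2 + 1)), (row_mx 0 1%:M : 'rV_(2 + 1))) =
  dsubmx (shat (row_mx A b) : 'cV_(2 + 1)) 0 0.
Proof.
have E (z : 'cV[C]_(2 + 1)) : (row_mx 0 1%:M *m z) 0 0 = dsubmx z 0 0.
  by rewrite -[z]vsubmxK mul_row_col mul0mx add0r mul1mx col_mxKd.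
exact: E.
Qed.

(** The superpotential at ((A | t e_j), e^3) is t times the j-th component of
p_* s at A, by the homogeneity of shat in the last column. *)
Lemma flat_last_column A j :
  flat_along W (neg_embedding A) (row_mx (0 : 'M_(5, 2)) (delta_mx j 0 : 'cV_5), 0) <->
  ppush s A j 0 = 0.
Proof.
have E t : W (neg_embedding A + t *: (row_mx (0 : 'M_(5, 2)) (delta_mx j 0 : 'cV_5), 0)) =
    (ppush s A j 0 *: 'X).[t].
  rewrite -(shat_ppush hs shat_poly hshat) hornerZ hornerX.
  have -> : neg_embedding A + t *: (row_mx (0 : 'M_(5, 2)) (delta_mx j 0 : 'cV_5), 0) =
      ((row_mx A (t *: delta_mx j 0) : 'M_(5, 2 + 1)), (row_mx 0 1%:M : 'rV_(2 + 1))).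
    have E1 : row_mx A (0 : 'cV_5) + t *: row_mx 0 (delta_mx j 0) =
        row_mx A (t *: delta_mx j 0).
      by rewrite scale_row_mx add_row_mx scaler0 addr0 add0r.
    by congr pair; rewrite /= ?scaler0 ?addr0 //; apply: E1.
  rewrite superpotential_last.
  have [_ ->] := shat_scale_last hs shat_poly hshat A (delta_mx j 0) t.
  by rewrite mxE scale1r mulrC.
split=> [[P EP P1]|p0].
  have EP' : P = ppush s A j 0 *: 'X by apply: poly_fun_inj => t; rewrite -EP E.
  by move: P1; rewrite EP' coefZ coefX mulr1.
by exists (ppush s A j 0 *: 'X) => //; rewrite p0 scale0r coef0.
Qed.

(** As shat vanishes on all (A' | 0), the superpotential is constant along
directions that change omega or the first two columns, so that only the last
column contributes equations. *)
Lemma crit_neg_embedding (A : 'M_(5, 2)) :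
  crit W (neg_embedding A) <-> ppush s A = 0.
Proof.
split=> [cA|p0].
  apply/colP => j; rewrite [RHS]mxE; apply/flat_last_column.
  exact: (critP _ polyW).1 cA _.
apply/(critP _ polyW) => -[b w].
have sh0 A' := shat_last0 hs shat_poly hshat A'.
pose b1 : 'M_(5, 2) := lsubmx (b : 'M_(5, 2 + 1)).
pose b2 : 'cV_5 := rsubmx (b : 'M_(5, 2 + 1)).
have flat0 : flat_along W (neg_embedding A) 0.
  exists (W (neg_embedding A))%:P => [t|]; first by rewrite scaler0 addr0 hornerC.
  by rewrite coefC.
have flat_w : flat_along W (neg_embedding A) (0, w).
  exists 0 => [t|]; rewrite ?coef0 // horner0 /superpotential /= scaler0 addr0 sh0.
  by rewrite mulmx0 mxE.
have flat_b1 : flat_along W (neg_embedding A) (row_mx b1 (0 : 'cV_5), 0).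
  exists 0 => [t|]; rewrite ?coef0 // horner0 /superpotential /=.
  have -> : (row_mx A 0 : 'M_(5, 2 + 1)) + t *: row_mx b1 0 = row_mx (A + t *: b1) 0.
    by rewrite scale_row_mx add_row_mx scaler0 addr0.
  by rewrite sh0 mulmx0 mxE.
have flat_b2 : flat_along W (neg_embedding A) (row_mx (0 : 'M_(5, 2)) b2, 0).
  have -> : b2 = \sum_j b2 j 0 *: delta_mx j 0.
    by rewrite {1}[b2]matrix_sum_delta; apply: eq_bigr => j _; rewrite big_ord1.
  elim/big_rec: _ => [|j c _ flat_c]; first by rewrite row_mx0; apply: flat0.
  have -> : (row_mx (0 : 'M_(5, 2)) (b2 j 0 *: delta_mx j 0 + c), 0) = b2 j 0 *:
      ((row_mx (0 : 'M_(5, 2)) (delta_mx j 0 : 'cV_5), 0) : model R) +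
      (row_mx (0 : 'M_(5, 2)) c, 0).
    have E : row_mx (0 : 'M_(5, 2)) (b2 j 0 *: delta_mx j 0 + c) =
        b2 j 0 *: row_mx (0 : 'M_(5, 2)) (delta_mx j 0) + row_mx 0 c.
      by rewrite scale_row_mx add_row_mx scaler0 add0r.
    by congr pair; rewrite /= ?scaler0 ?addr0 //; apply: E.
  apply: (flat_along_comb (b2 j 0) polyW _ flat_c).
  by apply/flat_last_column; rewrite p0 mxE.
have := flat_along_comb 1 polyW flat_b1 (flat_along_comb 1 polyW flat_b2 flat_w).
congr (flat_along W _ _); rewrite !scale1r; congr pair; rewrite /= ?addr0 ?add0r //.
have E : row_mx b1 0 + row_mx 0 b2 = (b : 'M_(5, 2 + 1)).
  by rewrite add_row_mx addr0 add0r hsubmxK.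
exact: E.
Qed.

End CriticalLocus.

(** * Semistable critical points in the two phases *)

Section StableCriticalLoci.
Variable R : realType.
Local Notation C := R[i].
Local Notation act := (@model_act R).
Variables (s : 'M[C]_(5, 2) -> 'M[C]_(5, 3) -> C) (shat : 'M[C]_(5, 3) -> 'cV[C]_3).
Hypothesis hs : section_O11 s.
Hypothesis shat_poly : forall j, polyfun (fun B => shat B j 0).
Hypothesis hshat : forall B, \rank B == 3%N -> shat B = qpush s B.
Hypothesis smoothY : smooth_zero_scheme (qpush s).
Local Notation W := (superpotential shat).

(** The normal form of a semistable critical point in the positive phase. *)
Definition pos_embedding (B : 'M[C]_(5, 3)) : model R := (B, 0).

Lemma act_pos_embedding h B : act h (pos_embedding B) = pos_embedding (B *m invmx h).
Proof. by rewrite /model_act /= mul0mx scaler0. Qed.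

Lemma stable_crit_pos (tau : int) (x : model R) : 0 < tau ->
  (crit W `&` semistable act (rho tau)) x <->
  exists B h, [/\ \rank B == 3%N, qpush s B = 0, h \in unitmx & x = act h (pos_embedding B)].
Proof.
move=> tau0; split=> [[cx /(semistable_pos _ tau0) rB]|[B [h [rB sB uh ->]]]].
  exists x.1, 1%:M; rewrite act_pos_embedding invmx1 mulmx1 unitmx1; split=> //.
    by rewrite -hshat // (crit_shat0 shat_poly cx).
  by case: x cx rB => B w cx /= rB; rewrite (crit_smooth shat_poly hshat smoothY rB cx).
rewrite act_pos_embedding.
have rB' : \rank (B *m invmx h) == 3%N by rewrite mxrank_unitr ?unitmx_inv.
split; last by apply/semistable_pos.
apply: crit_zero_covector => //.
by rewrite hshat // (qpush_equivariant hs rB uh) sB mulmx0 scaler0.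
Qed.

Lemma rank_act_model (X : 'M[C]_(5, 3)) (e : 'rV_3) c h : c != 0 -> h \in unitmx ->
  \rank (col_mx (X *m invmx h) (c *: (e *m invmx h))) = \rank (col_mx X e).
Proof.
move=> c0 uh; have -> : col_mx (X *m invmx h) (c *: (e *m invmx h)) =
    block_mx 1%:M 0 0 c%:M *m (col_mx X e *m invmx h).
  rewrite [col_mx X e *m _]mul_col_mx mul_block_col !mul0mx addr0 add0r mul1mx.
  by rewrite mul_scalar_mx.
rewrite mxrank_full_mull ?mxrank_unitr ?unitmx_inv //.
apply/eqP/mxrank_unit.
by rewrite unitmxE det_ublock det1 det_scalar1 mul1r unitfE.
Qed.

(** Smoothness of Y excludes rank 3, as omega is nonzero, and semistability then
forces rank 2 and makes the kernel of B a complement of that of omega. The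
matrix U makes the last column of B zero, and D absorbs the factor det^2 in
front of omega. *)
Lemma stable_crit_neg (tau : int) (x : model R) : tau < 0 ->
  (crit W `&` semistable act (rho tau)) x <->
  exists A h, [/\ \rank A == 2%N, ppush s A = 0, h \in unitmx & x = act h (neg_embedding A)].
Proof.
have equi := shat_equivariant hs shat_poly hshat.
move=> tau0; split=> [[cx /(semistable_neg _ tau0)[w0 rM]]|[A [h [rA sA uh ->]]]].
  case: x cx w0 rM => B w cx /= w0 rM.
  have [A [b [g [ug EB Ew rA]]]] := covector_frame B w0.
  have {}rA : \rank A == 2%N by move: rM; rewrite rA addn1 eqSS.
  have rAb : \rank (row_mx A b) == 2%N.
    have le2 : (\rank (row_mx A b) <= 2)%N.
      rewrite -ltnS; have -> : \rank (row_mx A b) = \rank B by rewrite EB mxrank_unitr.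
      rewrite ltn_neqAle rank_leq_col andbT; apply/negP => rB.
      by move: w0; rewrite (crit_smooth shat_poly hshat smoothY rB cx) eqxx.
    rewrite eqn_leq le2 -{1}(eqP rA).
    have := mxrankM_maxl (row_mx A b) (col_mx 1%:M 0).
    by rewrite mul_row_col mulmx1 mulmx0 addr0.
  have [c Ec] : exists c, b = A *m c.
    have sub : (A^T <= (row_mx A b)^T)%MS by rewrite tr_row_mx -addsmxE addsmxSl.
    have : (b^T <= A^T)%MS.
      have /eqmxP eqA : (A^T == (row_mx A b)^T)%MS.
        by rewrite -(geq_leqif (mxrank_leqif_eq sub)) !mxrank_tr (eqP rA) (eqP rAb).
      by rewrite eqA tr_row_mx -addsmxE addsmxSr.
    by move=> /submxP[D /(congr1 trmx)]; rewrite trmx_mul !trmxK => ->; exists D^T.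
  pose U : 'M[C]_(2 + 1) := block_mx 1%:M c 0 1%:M.
  have dU : \det U = 1 by rewrite det_ublock !det1 mulr1.
  pose k : 'M[C]_3 := U *m g.
  have dk : \det k != 0 by rewrite det_mulmx dU mul1r -unitfE -unitmxE.
  (* The value of d solves det (D *m k) ^- 2 * d = 1. *)
  pose d := (\det k) ^- 2; have d0 : d != 0 by rewrite invr_eq0 expf_neq0.
  pose D : 'M[C]_(2 + 1) := block_mx 1%:M 0 0 d%:M.
  have dD : \det D = d by rewrite det_ublock det1 mul1r det_scalar1.
  have dDk : \det ((D : 'M_3) *m k) = d * \det k by rewrite det_mulmx -dD.
  have uDk : (D : 'M_3) *m k \in unitmx by rewrite unitmxE unitfE dDk mulf_neq0.
  have AD : row_mx A (0 : 'cV_5) *m D = row_mx A 0.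
    by rewrite mul_row_block !mulmx0 mul0mx mulmx1 !addr0.
  have AU : row_mx A (0 : 'cV_5) *m U = row_mx A b.
    by rewrite mul_row_block !mul0mx mulmx1 !addr0 Ec.
  have eD : row_mx (0 : 'rV_2) 1%:M *m D = d *: row_mx 0 1%:M.
    by rewrite mul_row_block !mulmx0 mul0mx mul1mx addr0 add0r scale_row_mx scaler0 scalemx1.
  have eU : row_mx (0 : 'rV_2) 1%:M *m U = row_mx 0 1%:M.
    by rewrite mul_row_block !mul0mx mulmx0 mul1mx !add0r.
  have Ex : (B, w) = act (invmx (D *m k)) (neg_embedding A).
    have : (\det ((D : 'M_3) *m k)) ^- 2 * d = 1.
      by rewrite dDk /d; move: (\det k) dk => e e0; field.
    rewrite act_invmx //; move: (_ ^- 2) => e ed1.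
    by rewrite !mulmxA AD AU eD -scalemxAl eU -EB -scalemxAl -Ew scalerA ed1 scale1r.
  exists A, (invmx (D *m k)); rewrite unitmx_inv uDk; split=> //.
  apply/(crit_neg_embedding hs shat_poly hshat).
  have := crit_act shat_poly equi uDk cx; rewrite Ex.
  rewrite -model_act_comp ?unitmx_inv // mulmxV // /model_act /= invmx1 det1.
  by rewrite expr1n scale1r !mulmx1.
split.
  apply: (crit_act shat_poly equi uh).
  exact/(crit_neg_embedding hs shat_poly hshat).
have dh : \det h ^+ 2 != 0 by rewrite expf_neq0 // -unitfE -unitmxE.
apply/semistable_neg => //=; split.
  rewrite scalemx_eq0 negb_or dh /=; apply/eqP => e0.
  have : (row_mx 0 1%:M : 'rV[C]_(2 + 1)) = 0.
    by have := congr1 (fun M => M *m h) e0; rewrite mulmxKV // mul0mx.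
  move=> /(congr1 (@rsubmx _ 1 2 1)); rewrite row_mxKr linear0 => /matrixP/(_ 0 0).
  by rewrite !mxE => /eqP; rewrite oner_eq0.
have rX : \rank (col_mx (row_mx A (0 : 'cV_5)) (row_mx 0 (1%:M : 'M_1))) = 3%N.
  have := rank_diag_block_mx A (1%:M : 'M[C]_1); rewrite mxrank1 (eqP rA).
  exact: id.
by rewrite rank_act_model // rX.
Qed.

(** The point (B, 0) with B injective is semistable for positive characters
only. *)
Lemma same_phase_sign (tau tau' : int) : tau != 0 -> tau' != 0 ->
  same_phase act (rho tau) (rho tau') <-> (0 < tau) = (0 < tau').
Proof.
have sep t t' : 0 < t -> t' < 0 -> ~ same_phase act (rho t) (rho t').
  move=> t0 t'0 same; pose x : model R := (pid_mx 3, 0).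
  have : semistable act (rho t) x by apply/semistable_pos => //=; rewrite rank_pid_mx.
  by rewrite same => /(semistable_neg _ t'0)[]; rewrite /= eqxx.
move=> t0 t'0; split=> [same|].
  have [t_pos|t_neg|t_eq] := ltgtP 0 tau; last by rewrite -t_eq eqxx in t0.
    have [//|t'_neg|t'_eq] := ltgtP 0 tau'; last by rewrite -t'_eq eqxx in t'0.
    by case: (sep _ _ t_pos t'_neg).
  have [t'_pos|//|//] := ltgtP 0 tau'.
  by case: (sep _ _ t'_pos t_neg).
have [t_pos|t_neg|t_eq] := ltgtP 0 tau; last by rewrite -t_eq eqxx in t0.
  move=> /esym t'_pos; apply/seteqP; split=> x /=.
    by move=> /(semistable_pos _ t_pos) /(semistable_pos _ t'_pos).
  by move=> /(semistable_pos _ t'_pos) /(semistable_pos _ t_pos).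
have [//|t'_neg|t'_eq] := ltgtP 0 tau'; last by rewrite -t'_eq eqxx in t'0.
move=> _; apply/seteqP; split=> x /=.
  by move=> /(semistable_neg _ t_neg) /(semistable_neg _ t'_neg).
by move=> /(semistable_neg _ t'_neg) /(semistable_neg _ t_neg).
Qed.

End StableCriticalLoci.

(** * Grassmannians as spaces of matrices *)

Section ColumnSpaces.
Variable R : realType.
Local Notation C := R[i].

Lemma same_column_space m k (A B : 'M[C]_(m, k)) : \rank A == k ->
  (A^T == B^T)%MS -> exists2 u, u \in unitmx & B = A *m invmx u.
Proof.
move=> rA AB; have /submxP[D /(congr1 trmx)] : (B^T <= A^T)%MS by rewrite (eqmxP AB).
rewrite trmx_mul !trmxK => EB.
have rB : \rank B == k by rewrite -mxrank_tr -(eqmxP AB) mxrank_tr.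
have uD : D^T \in unitmx.
  by rewrite -row_free_unit /row_free -(mxrank_full_mull D^T rA) -EB.
by exists (invmx D^T); rewrite ?unitmx_inv // invmxK.
Qed.

Lemma column_space_mulmx m k (A : 'M[C]_(m, k)) u : u \in unitmx ->
  ((A *m u)^T :=: A^T)%MS.
Proof.
move=> uu; apply/eqmxP; rewrite trmx_mul; apply/andP; split; first exact: submxMl.
apply/submxP; exists (invmx u^T); by rewrite mulKmx // unitmx_tr.
Qed.

(** The equivalence relation of which Gr is the quotient. *)
Definition same_frame k (A B : frames R k) : Prop :=
  exists2 g : 'M[C]_k, g \in unitmx & sval B = sval A *m invmx g.

Lemma eq_GrP k (A B : frames R k) :
  eqclass (@same_frame k) A = eqclass (@same_frame k) B <-> ((sval A)^T == (sval B)^T)%MS.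
Proof.
have AB : same_frame A B <-> ((sval A)^T == (sval B)^T)%MS.
  split=> [[g ug ->]|]; last exact: same_column_space (svalP A).
  by apply/eqmxP/eqmx_sym/column_space_mulmx; rewrite unitmx_inv.
rewrite -AB; apply: eqclass_eq.
- by move=> Z; exists 1%:M; rewrite ?unitmx1 // invmx1 mulmx1.
- move=> U V [g ug EV]; exists (invmx g); rewrite ?unitmx_inv // invmxK EV.
  by rewrite mulmxKV.
- move=> U V Z [g ug EV] [h uh EZ]; exists (h *m g); first by rewrite unitmx_mul uh.
  by rewrite EZ EV invmx_mul // mulmxA.
Qed.

Lemma full_rank_open k : isopen ([set A | \rank A == k] : set (affine 'M[C]_(5, k))).
Proof.
apply: (open_local (affine_sheafy _)) => A rA; have [L dL] := det_of_rank rA.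
have algP := polyfun_alg 'M[C]_(5, k).
exists [set A | \det (L *m A) != 0]; split=> //; last by move=> B; apply: rank_of_det.
apply: open_polyfun; apply: (subalg_det algP) => i j.
apply: (subalg_mulmx algP) => l; first exact: (subalgC algP).
exact: polyfun_entry.
Qed.

(** Frames form an open set of matrices, so an open set of the Grassmannian is
the image of an open set in an affine space. *)
Lemma Gr_open k (V : set (Gr R k)) : isopen V -> exists V' : set (affine 'M[C]_(5, k)),
  [/\ isopen V', forall A, V' A -> \rank A == k &
      forall A : frames R k, V (eqclass (@same_frame k) A) <-> V' (sval A)].
Proof.
move=> [V0 oV0 EV]; exists (V0 `&` [set A | \rank A == k]); split.
- exact: (openI (affine_sheafy _) oV0 (@full_rank_open k)).
- by move=> A [].
- move=> A; have := congr1 (fun U : set (frames R k) => U A) EV; rewrite /= => ->.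
  by split=> [VA|[]//]; split=> //; apply: (svalP A).
Qed.

(** A function on the Grassmannian pulls back to the open set of frames in the
affine space of matrices. Outside the frames the value of h' is arbitrary. *)
Lemma Gr_regular k (V : set (Gr R k)) (V' : set (affine 'M[C]_(5, k))) h :
  isopen V' -> (forall A, V' A -> \rank A == k) ->
  (forall A : frames R k, V (eqclass (@same_frame k) A) <-> V' (sval A)) ->
  regular V h -> exists2 h' : 'M[C]_(5, k) -> C, regular V' h' &
    forall A : frames R k, h' (sval A) = h (eqclass (@same_frame k) A).
Proof.
move=> oV' rV' VV' hV.
have /choice[h' h'P] : forall A : 'M[C]_(5, k), exists c : C, forall B : frames R k,
    sval B = A -> c = h (eqclass (@same_frame k) B).
  move=> A; have [rA|nrA] := pselect (\rank A == k).
    exists (h (eqclass (@same_frame k) (exist _ A rA))) => B EB.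
    by congr (h (eqclass _ _)); apply: subspace_inj.
  by exists 0 => B EB; case: nrA; rewrite -EB; apply: (svalP B).
have {}h'P A : h' (sval A) = h (eqclass (@same_frame k) A) by apply: h'P.
exists h' => //; apply: (regular_local (affine_sheafy _) oV') => A VA.
pose fA : frames R k := exist _ A (rV' A VA).
have [W [f [oW WA fW fh]]] := hV fA ((VV' fA).2 VA).
exists W, f; split=> // B WB VB; pose fB : frames R k := exist _ B (rV' B VB).
by have [_ fhB] := fh fB WB; apply: etrans (h'P fB) fhB.
Qed.

End ColumnSpaces.

(** * Quotients that parametrize column spaces *)

Section GitQuotients.
Variable R : realType.
Local Notation C := R[i].
Local Notation act := (@model_act R).

(** The inclusion in the column space of x.1 is a system of linear equations
that holds along the orbit. *)
Lemma zclosure_column_space (x z : model R) :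
  zclosure (orbit_of act x) z -> (z.1^T <= x.1^T)%MS.
Proof.
move=> cl; rewrite submxE; apply/eqP/matrixP => k l; rewrite [RHS]mxE.
have algP := polyfun_alg (model R).
have [p Ep] : polyfun (fun y : model R => (y.1^T *m cokermx x.1^T) k l).
  apply: (subalg_mulmx algP) => j; last exact: (subalgC algP).
  by under eq_fun do [rewrite mxE]; apply: polyfun_model1.
rewrite (Ep z); apply: cl => _ [g ug ->]; rewrite -Ep /=.
by rewrite trmx_mul -mulmxA mulmx_coker mulmx0 mxE.
Qed.

Variables (k m : nat) (sigma : 'M[C]_(5, k) -> 'cV[C]_m).
Variables (emb : 'M[C]_(5, k) -> model R) (S : set (model R)).
Hypothesis sigma_poly : exists p, poly_extension sigma p.
Hypothesis sigma_act : forall A u, \rank A == k -> u \in unitmx ->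
  sigma A = 0 -> sigma (A *m invmx u) = 0.
Hypothesis emb_poly : coords_in (@polyfun R 'M[C]_(5, k)) emb.
Hypothesis emb_span : forall A, ((emb A).1^T == A^T)%MS.
Hypothesis emb_act : forall A u, u \in unitmx ->
  exists2 g, g \in unitmx & emb (A *m invmx u) = act g (emb A).
Hypothesis SP : forall x, S x <-> exists A h,
  [/\ \rank A == k, sigma A = 0, h \in unitmx & x = act h (emb A)].

Local Notation SS := (subspace (X := affine (model R)) S).
Local Notation E := (fun x y : SS => exists2 z, S z &
  zclosure (orbit_of act (sval x)) z /\ zclosure (orbit_of act (sval y)) z).
Local Notation F := (@same_frame R k).
Local Notation M := (git_quotient act S).
Local Notation Z := (zero_locus sigma).

Let S_frame (x : SS) : exists A : frames R k,
  sigma (sval A) = 0 /\ ((sval A)^T == (sval x).1^T)%MS.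
Proof.
have [A [h [rA sA uh ->]]] := (SP (sval x)).1 (svalP x).
exists (exist _ A rA); split=> //=; apply/eqmxP/eqmx_sym.
apply: eqmx_trans (eqmxP (emb_span A)).
by apply: column_space_mulmx; rewrite unitmx_inv.
Qed.

Let emb_S (A : frames R k) : sigma (sval A) = 0 -> S (emb (sval A)).
Proof.
move=> sA; apply/SP; exists (sval A), 1%:M; rewrite unitmx1 (svalP A); split=> //.
by rewrite /model_act invmx1 det1 expr1n scale1r !mulmx1; case: (emb _).
Qed.

Let act_comp (g h : 'M[C]_3) x : g \in unitmx -> h \in unitmx ->
  act g (act h x) = act (g *m h) x.
Proof. by move=> ug uh; rewrite model_act_comp. Qed.

Let eq_MP (x y : SS) :
  eqclass E x = eqclass E y <-> ((sval x).1^T == (sval y).1^T)%MS.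
Proof.
have rS (z : model R) : S z -> \rank z.1^T = k.
  move=> Sz; have [A [_ /eqmxP <-]] := S_frame (exist _ z Sz).
  by rewrite mxrank_tr; apply/eqP/(svalP A).
have inS u v : E u v <-> ((sval u).1^T == (sval v).1^T)%MS.
  split=> [[z Sz [/zclosure_column_space zu /zclosure_column_space zv]]|].
    have eq_z (w : SS) :
        (z.1^T <= (sval w).1^T)%MS -> (z.1^T == (sval w).1^T)%MS.
      by move=> zw; rewrite -(geq_leqif (mxrank_leqif_eq zw)) !rS //; apply: (svalP w).
    apply/eqmxP; apply: eqmx_trans (eqmx_sym (eqmxP (eq_z u zu))) _.
    exact/eqmxP/eq_z.
  move=> uv; exists (sval v); first exact: (svalP v).
  have [A [h [rA sA uh Eu]]] := (SP (sval u)).1 (svalP u).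
  have [B [g [rB sB ug Ev]]] := (SP (sval v)).1 (svalP v).
  have span (w : model R) D l : l \in unitmx -> w = act l (emb D) -> (w.1^T :=: D^T)%MS.
    move=> ul ->; apply: eqmx_trans (eqmxP (emb_span D)).
    by apply: column_space_mulmx; rewrite unitmx_inv.
  have AB : (A^T == B^T)%MS.
    apply/eqmxP; apply: eqmx_trans (eqmx_sym (span _ _ _ uh Eu)) _.
    exact: eqmx_trans (eqmxP uv) (span _ _ _ ug Ev).
  have [l ul EB] := same_column_space rA AB; have [l' ul' El'] := emb_act A ul.
  split; move=> p p0; apply: p0.
    have ugl : g *m l' *m invmx h \in unitmx by rewrite !unitmx_mul ug ul' unitmx_inv.
    exists (g *m l' *m invmx h); first exact: ugl.
    have Euv : act (g *m l' *m invmx h) (act h (emb A)) = act g (act l' (emb A)).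
      rewrite (act_comp _ ugl uh) (act_comp _ ug ul').
      exact: (congr1 (fun l => act l (emb A)) (mulmxKV uh _)).
    rewrite Eu Euv -El' -EB; exact: Ev.
  exists 1%:M; first exact: unitmx1.
  by rewrite /model_act invmx1 det1 expr1n scale1r !mulmx1; case: (sval v).
apply: iff_trans (inS x y); apply: eqclass_eq => [z|u v|u v w].
- by apply/inS/eqmxP.
- by move=> /inS/eqmxP uv; apply/inS/eqmxP/eqmx_sym.
- move=> /inS/eqmxP uv /inS/eqmxP vw; apply/inS/eqmxP; exact: eqmx_trans uv vw.
Qed.

Let sigma_class (A B : frames R k) :
  eqclass F A = eqclass F B -> sigma (sval A) = 0 -> sigma (sval B) = 0.
Proof.
move=> /eq_GrP AB sA; have [u uu ->] := same_column_space (svalP A) AB.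
by apply: sigma_act => //; apply: (svalP A).
Qed.

Let zero_locus_sigma (A : frames R k) :
  (forall B, sval (eqclass F A) B -> sigma (sval B) = 0) <-> sigma (sval A) = 0.
Proof.
split=> [|sA B [g ug ->]]; last by apply: sigma_act => //; apply: (svalP A).
by apply; exists 1%:M; rewrite ?unitmx1 // invmx1 mulmx1.
Qed.

Let zero_locus_frame (z : Z) :
  exists A : frames R k, sval z = eqclass F A /\ sigma (sval A) = 0.
Proof.
have [A zA] := quotient_repr (sval z); exists A; split=> //.
by apply/zero_locus_sigma; rewrite -zA; apply: (svalP z).
Qed.

(** Locally on S a basis of the column space of x.1 is given by x.1 *m K with K
constant, so that functions on the Grassmannian pull back to regular functions. *)
Lemma quotient_to_zero_locus (f : M -> Z) :
  (forall (x : SS) (A : frames R k), ((sval A)^T == (sval x).1^T)%MS ->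
    sval (f (eqclass E x)) = eqclass F A) -> morphism f.
Proof.
move=> fE; apply: morphism_subspace => [|V oV].
  exact/quotient_sheafy/subspace_sheafy/affine_sheafy.
have [V' [oV' rV' VV']] := Gr_open oV.
have column_map (K : 'M[C]_(3, k)) :
    regmap (setT : set (affine (model R))) (fun x : model R => x.1 *m K : 'M_(5, k)).
  apply: (coords_in_mx (regular_alg _)) => i j.
  apply: (subalg_mulmx (regular_alg _)) => l; last exact: (subalgC (regular_alg _)).
  by apply: polyfun_regular; apply: polyfun_model1.
have open_K K := open_preimage (@openT _ _) (column_map K) oV'.
(* For points of S, the columns of x.1 *m K form a basis of the column space
   as soon as they are independent. *)
have frame_K (x : SS) (K : 'M[C]_(3, k)) (rK : \rank ((sval x).1 *m K) == k) :
    sval (f (eqclass E x)) = eqclass F (exist _ ((sval x).1 *m K) rK).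
  apply: fE; have [A [_ /eqmxP Ax]] := S_frame x.
  have sub : (((sval x).1 *m K)^T <= (sval x).1^T)%MS by rewrite trmx_mul submxMl.
  by rewrite -(geq_leqif (mxrank_leqif_eq sub)) -Ax !mxrank_tr (eqP (svalP A)) (eqP rK).
have some_K (x : SS) : exists K : 'M[C]_(3, k), \rank ((sval x).1 *m K) == k.
  have [A [_ /eqmxP Ax]] := S_frame x; have /submxP[D ED] : ((sval A)^T <= (sval x).1^T)%MS.
    by rewrite Ax.
  by exists D^T; rewrite -mxrank_tr trmx_mul trmxK -ED mxrank_tr; apply: (svalP A).
have VK (x : SS) (K : 'M[C]_(3, k)) : V' ((sval x).1 *m K) -> V (sval (f (eqclass E x))).
  by move=> VxK; rewrite (frame_K x K (rV' _ VxK)); apply/VV'.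
have KV (x : SS) (K : 'M[C]_(3, k)) : \rank ((sval x).1 *m K) == k ->
    V (sval (f (eqclass E x))) -> V' ((sval x).1 *m K).
  by move=> rK; rewrite (frame_K x K rK) => /VV'.
split.
  exists [set x : model R | exists K : 'M[C]_(3, k), V' (x.1 *m K)].
    apply: (open_local (affine_sheafy _)) => x [K VxK].
    exists (setT `&` (fun x : model R => x.1 *m K : 'M_(5, k)) @^-1` V').
    by split; [exact: open_K | by [] | move=> y [_ VyK]; exists K].
  apply/seteqP; split=> [x Vx|x [K VxK]]; last exact: VK VxK.
  by have [K rK] := some_K x; exists K; apply: KV.
move=> h /(Gr_regular oV' rV' VV')[h' rh' hh'] x Vx.
have [K rK] := some_K x.
exists (setT `&` (fun x : model R => x.1 *m K : 'M_(5, k)) @^-1` V').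
exists (fun x : model R => h' (x.1 *m K)); split.
+ exact: open_K.
+ by split=> //; apply: KV.
+ exact: (regular_comp (@openT _ _) (column_map K) oV' rh').
+ move=> y [_ VyK]; split; first exact: VK VyK.
  by rewrite /= (frame_K y K (rV' _ VyK)) -hh'.
Qed.

(** The quotient of the frames has local sections: where L *m A is invertible,
each column space has exactly one basis with L *m A = 1. They extend the functions
on the zero locus to the ambient Grassmannian, and the closedness of the zeros
extends its open sets. *)
Lemma zero_locus_to_quotient (g : Z -> M) :
  (forall (z : Z) (x : SS) (A : frames R k), sval z = eqclass F A ->
    ((sval A)^T == (sval x).1^T)%MS -> g z = eqclass E x) -> morphism g.
Proof.
move=> gE U oU.
have gzE z (A : frames R k) (sA : sigma (sval A) = 0) : sval z = eqclass F A ->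
    g z = eqclass E (exist _ (emb (sval A)) (emb_S sA)).
  by move=> zA; apply: gE zA _; apply/eqmxP/eqmx_sym/eqmxP/emb_span.
have [W oW EW] := oU.
have UW (x : SS) : U (eqclass E x) <-> W (sval x).
  by have := congr1 (fun X : set SS => X x) EW; rewrite /= => ->.
have emb_map : regmap (setT : set (affine 'M[C]_(5, k))) emb.
  by move=> j; apply: polyfun_regular.
have oWemb := open_preimage (@openT _ _) emb_map oW.
split.
  (* The open set W only matters at zeros of sigma; adding all other frames makes
     the set invariant. *)
  pose V'' : set (affine 'M[C]_(5, k)) := [set A | sigma A != 0 \/ W (emb A)].
  exists [set c | exists2 A : frames R k, c = eqclass F A & V'' (sval A)].
    have [p ext] := sigma_poly.
    have sE A : \rank A == k -> (sigma A != 0) <-> exists i, peval (p i) A != 0.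
      move=> rA; split=> [sA|[i piA]].
        apply: contrapT => /forallNP pA; case/eqP: sA; apply/colP => i; rewrite mxE (ext A rA).
        by apply: contrapT => /eqP; apply: pA.
      by apply: contraNneq piA => sA; rewrite -(ext A rA) sA mxE.
    exists [set A | (exists i, peval (p i) A != 0) \/ W (emb A)].
      apply: (open_local (affine_sheafy _)) => A [[i piA]|WA].
        exists [set B | peval (p i) B != 0]; split=> //; last by move=> B piB; left; exists i.
        by apply: open_polyfun; exists (p i).
      by exists (setT `&` emb @^-1` W); split=> // B [_ WB]; right.
    apply/seteqP; split=> A /=.
      move=> [B AB [sB|WB]].
        left; apply/sE; first exact: (svalP A).
        by apply: contra_neq sB; apply: sigma_class.
      have [sA|sA] := eqVneq (sigma (sval A)) 0; last first.
        by left; apply/sE => //; apply: (svalP A).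
      have sB : sigma (sval B) = 0 by apply: sigma_class sA.
      right; apply/(UW (exist _ _ (emb_S sA))).
      suff -> : eqclass E (exist _ _ (emb_S sA)) = eqclass E (exist _ _ (emb_S sB)).
        by apply/UW.
      apply/eq_MP/eqmxP; apply: eqmx_trans (eqmxP (emb_span _)) _.
      apply: eqmx_trans (eqmx_sym (eqmxP (emb_span _))); exact/eqmxP/eq_GrP.
    move=> V''A; exists A => //; case: V''A => [/sE sA|]; last by right.
    by left; apply: sA; apply: (svalP A).
  apply/seteqP; split=> z /=; have [A [zA sA]] := zero_locus_frame z.
    move=> Uz; exists A => //; right; apply/(UW (exist _ _ (emb_S sA))).
    by rewrite -(gzE z A sA zA).
  move=> [B zB [/eqP[]|WB]]; first by apply: sigma_class sA; rewrite -zA -zB.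
  have sB : sigma (sval B) = 0 by apply: sigma_class sA; rewrite -zA -zB.
  by rewrite (gzE z B sB zB); apply/UW.
move=> h rh z Uz; have [A0 [zA0 sA0]] := zero_locus_frame z.
have [L dL] := det_of_rank (svalP A0).
have algP := polyfun_alg 'M[C]_(5, k).
have pL i j : polyfun (fun A : 'M[C]_(5, k) => (L *m A) i j).
  apply: (subalg_mulmx algP) => l; first exact: (subalgC algP).
  exact: polyfun_entry.
pose D : set (affine 'M[C]_(5, k)) := [set A | \det (L *m A) != 0].
have oD : isopen D by apply: open_polyfun; apply: (subalg_det algP).
have algD := regular_alg D.
(* The representative A of a column space with L *m A = 1. *)
pose nf (A : 'M[C]_(5, k)) : 'M[C]_(5, k) := A *m ((\det (L *m A))^-1 *: \adj (L *m A)).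
have nfE A : D A -> nf A = A *m invmx (L *m A).
  by move=> DA; rewrite /nf /invmx unitmxE unitfE DA.
have nf_class A u : D A -> u \in unitmx -> D (A *m invmx u) /\ nf (A *m invmx u) = nf A.
  move=> DA uu; have uLA : L *m A \in unitmx by rewrite unitmxE unitfE.
  have uV : invmx u \in unitmx by rewrite unitmx_inv.
  have DAu : D (A *m invmx u).
    by rewrite /D /= mulmxA -unitfE -unitmxE unitmx_mul uLA.
  split; first exact: DAu.
  rewrite (nfE A DA) (nfE _ DAu) mulmxA (invmx_mul uLA uV) invmxK mulmxA.
  by rewrite (mulmxKV uu).
have nf_map : regmap D nf.
  apply: (coords_in_mx algD) => i j; apply: (subalg_mulmx algD) => l.
    by apply: polyfun_regular; apply: polyfun_entry.
  under eq_fun do [rewrite mxE]; apply: (subalgM algD).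
    apply: regular_inv => //; apply: polyfun_regular; exact: (subalg_det algP).
  by apply: (subalg_adj algD) => i' j'; apply: polyfun_regular.
have N_map : regmap D (fun A => emb (nf A)).
  move=> j; exact: (coords_in_polyfun algD nf_map (emb_poly j)).
have nf_frame (A : frames R k) : D (sval A) -> \rank (nf (sval A)) == k.
  move=> DA; rewrite nfE // mxrank_unitr ?unitmx_inv; first exact: (svalP A).
  by rewrite unitmxE unitfE.
have nf_sigma (A : frames R k) : D (sval A) -> sigma (sval A) = 0 -> sigma (nf (sval A)) = 0.
  move=> DA; rewrite nfE //; apply: sigma_act; first exact: (svalP A).
  by rewrite unitmxE unitfE.
have nf_point (w : Z) (A : frames R k) (DA : D (sval A)) : sval w = eqclass F A ->
    exists2 x : SS, sval x = emb (nf (sval A)) & g w = eqclass E x.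
  move=> wA; have sA : sigma (sval A) = 0.
    by apply/zero_locus_sigma; rewrite -wA; apply: (svalP w).
  pose nA : frames R k := exist _ (nf (sval A)) (nf_frame A DA).
  have snA : sigma (sval nA) = 0 := nf_sigma A DA sA.
  exists (exist _ (emb (sval nA)) (emb_S snA)); first by [].
  apply: gE wA _ => /=; apply/eqmxP/eqmx_sym; apply: eqmx_trans (eqmxP (emb_span _)) _.
  by rewrite nfE //; apply: column_space_mulmx; rewrite unitmx_inv unitmxE unitfE.
have [x0 Ex0 gz] := nf_point z A0 dL zA0.
have [|W0 [H [oW0 W0x rH hH]]] := rh x0; first by rewrite /= -gz.
pose D' : set (affine 'M[C]_(5, k)) := D `&` (fun A => emb (nf A)) @^-1` W0.
have oD' : isopen D' := open_preimage oD N_map oW0.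
have rN : regular D' (fun A => H (emb (nf A))) := regular_comp oD N_map oW0 rH.
have nf_eqclass (A B : frames R k) : eqclass F A = eqclass F B -> D (sval A) ->
    D (sval B) /\ nf (sval B) = nf (sval A).
  move=> /eq_GrP AB DA; have [u uu ->] := same_column_space (svalP A) AB.
  exact: nf_class.
have D'_eqclass (A B : frames R k) : eqclass F A = eqclass F B -> D' (sval A) -> D' (sval B).
  move=> AB [DA WA]; have [DB EB] := nf_eqclass A B AB DA.
  by split; [exact: DB | rewrite /= EB].
have /choice[h' h'P] : forall c : Gr R k, exists v : C, forall A : frames R k,
    c = eqclass F A -> D (sval A) -> v = H (emb (nf (sval A))).
  move=> c; have [[A [cA DA]]|none] := pselect (exists A : frames R k,
      c = eqclass F A /\ D (sval A)).
    exists (H (emb (nf (sval A)))) => B cB _.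
    by have [|_ ->] := nf_eqclass A B _ DA; rewrite -?cA -?cB.
  by exists 0 => A cA DA; case: none; exists A.
exists [set c | exists2 A : frames R k, c = eqclass F A & D' (sval A)], h'; split.
- exists D'; first exact: oD'.
  apply/seteqP; split=> A /=; first by move=> [B AB DB]; apply: D'_eqclass DB.
  by move=> DA; exists A.
- by exists A0 => //; split; [exact: dL | rewrite /= -Ex0].
- move=> A [B AB DB]; have DA : D' (sval A) by apply: D'_eqclass DB.
  exists D', (fun A => H (emb (nf A))); split; [exact: oD' | exact: DA | exact: rN |].
  move=> A' DA'; split; first by exists A'.
  by have [DA1 _] := DA'; apply: (h'P _ A' erefl DA1).
- move=> y [A yA [DA WA]]; have [x Ex gy] := nf_point y A DA yA.
  have WAx : W0 (sval x) by rewrite Ex.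
  have [Ux hx] := hH x WAx; rewrite /preimage /= gy; split; first exact: Ux.
  by apply: etrans hx _; rewrite Ex (h'P _ A yA DA).
Qed.


(** Both spaces parametrize the column spaces of the zeros of sigma. *)
Lemma git_quotient_zero_locus : isomorphic M Z.
Proof.
have /choice[f fP] (c : M) : exists z : Z, exists x (A : frames R k),
    [/\ c = eqclass E x, sval z = eqclass F A & ((sval A)^T == (sval x).1^T)%MS].
  have [A [sA Ax]] := S_frame (repr c).
  exists (exist _ (eqclass F A) ((zero_locus_sigma A).2 sA)), (repr c), A.
  by split; [rewrite reprK | |].
have fE x (A : frames R k) : ((sval A)^T == (sval x).1^T)%MS ->
    sval (f (eqclass E x)) = eqclass F A.
  move=> /eqmxP Ax; have [y [B [xy -> /eqmxP By]]] := fP (eqclass E x).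
  apply/eq_GrP/eqmxP; apply: eqmx_trans By (eqmx_trans _ (eqmx_sym Ax)).
  exact/eqmx_sym/eqmxP/eq_MP.
have /choice[g gP] (z : Z) : exists c : M, exists x (A : frames R k),
    [/\ c = eqclass E x, sval z = eqclass F A & sval x = emb (sval A)].
  have [A [zA sA]]  := zero_locus_frame z.
  by exists (eqclass E (exist _ _ (emb_S sA))), (exist _ _ (emb_S sA)), A.
have gE z x (A : frames R k) : sval z = eqclass F A -> ((sval A)^T == (sval x).1^T)%MS ->
    g z = eqclass E x.
  move=> zA /eqmxP Ax; have [y [B [-> zB EB]]] := gP z.
  apply/eq_MP/eqmxP; apply: eqmx_trans Ax; rewrite EB.
  apply: eqmx_trans (eqmxP (emb_span _)) _.
  by apply/eqmxP/eq_GrP; rewrite -zA.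
exists f, g; split.
- exact: quotient_to_zero_locus.
- exact: zero_locus_to_quotient.
- move=> c; have [x [A [-> fx Ax]]] := fP c; exact: gE fx Ax.
- move=> z; apply: subspace_inj; have [x [A [-> -> Ex]]] := gP z.
  apply: fE; rewrite Ex; apply/eqmxP/eqmx_sym/eqmxP; exact: emb_span.
Qed.

End GitQuotients.

(** * The zeros of the two sections inside the model *)

Section Embeddings.
Variable R : realType.
Local Notation C := R[i].
Local Notation act := (@model_act R).

Lemma pos_embedding_poly : coords_in (@polyfun R 'M[C]_(5, 3)) (@pos_embedding R).
Proof.
have algP := polyfun_alg 'M[C]_(5, 3); apply: (coords_in_model algP) => [k l|l].
  exact: polyfun_entry.
by under eq_fun do [rewrite mxE]; apply: (subalgC algP).
Qed.

Lemma neg_embedding_poly : coords_in (@polyfun R 'M[C]_(5, 2)) (@neg_embedding R).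
Proof.
have algP := polyfun_alg 'M[C]_(5, 2); apply: (coords_in_model algP) => [k l|l].
  under eq_fun do [rewrite mxE]; case: (@split 2 1 l) => j; first exact: polyfun_entry.
  by under eq_fun do [rewrite mxE]; apply: (subalgC algP).
exact: (subalgC algP).
Qed.

Lemma neg_embedding_span (A : 'M[C]_(5, 2)) : ((neg_embedding A).1^T == A^T)%MS.
Proof.
have : ((row_mx A (0 : 'cV_5))^T :=: A^T)%MS.
  rewrite tr_row_mx trmx0; apply: eqmx_trans (eqmx_sym (addsmxE _ _)) _.
  exact: addsmx0.
by move=> E; apply/eqmxP.
Qed.

(** The last entry of the diagonal block is forced by the factor det^2 in the
action on omega. *)
Lemma neg_embedding_act (A : 'M[C]_(5, 2)) u : u \in unitmx ->
  exists2 g, g \in unitmx & neg_embedding (A *m invmx u) = act g (neg_embedding A).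
Proof.
move=> uu; have du : \det u != 0 by rewrite -unitfE -unitmxE.
pose h : 'M[C]_(2 + 1) := block_mx (invmx u) 0 0 (\det u ^+ 2)%:M.
have dh : \det h = \det u.
  by rewrite det_ublock det_inv det_scalar1 expr2 mulrA mulVf // mul1r.
have uh : h \in unitmx by rewrite unitmxE dh unitfE.
exists (invmx h); first by rewrite unitmx_inv.
have EA : row_mx A (0 : 'cV_5) *m h = row_mx (A *m invmx u) 0.
  by rewrite mul_row_block !mulmx0 mul0mx !addr0.
have Ee : row_mx (0 : 'rV_2) 1%:M *m h = \det u ^+ 2 *: row_mx 0 1%:M.
  by rewrite mul_row_block !mulmx0 mul0mx mul1mx addr0 add0r scale_row_mx scaler0 scalemx1.
have := @act_invmx R h (row_mx A (0 : 'cV_5)) (row_mx (0 : 'rV_2) 1%:M) uh.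
rewrite EA Ee dh scalerA mulVf ?expf_neq0 // scale1r => E.
exact: esym E.
Qed.

(** The matrix (A u^-1 | e_j) is (A | e_j) times a block-diagonal matrix, so each
component of p_* s is multiplied by a nonzero scalar. *)
Lemma ppush_act (s : 'M[C]_(5, 2) -> 'M[C]_(5, 3) -> C) (A : 'M_(5, 2)) u :
  section_O11 s -> \rank A == 2%N -> u \in unitmx ->
  ppush s A = 0 -> ppush s (A *m invmx u) = 0.
Proof.
move=> [_ equi] rA uu sA; apply/colP => j; rewrite mxE [RHS]mxE /=.
case: ifP => // rAu; pose e : 'cV[C]_5 := delta_mx j 0.
pose h : 'M[C]_(2 + 1) := block_mx (invmx u) 0 0 1%:M.
have uh : h \in unitmx.
  by rewrite unitmxE det_ublock det1 mulr1 -unitmxE unitmx_inv.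
have Eh : row_mx (A *m invmx u) e = row_mx A e *m h.
  by rewrite mul_row_block !mulmx0 mulmx1 addr0 add0r.
have rAe : \rank (row_mx A e) == 3%N by rewrite -(mxrank_unitr (row_mx A e) uh) -Eh.
have flag : flag_frames (A, row_mx A e : 'M_(5, 3)).
  split=> //; exists (col_mx 1%:M (0 : 'rV_2)).
  have E : row_mx A e *m col_mx 1%:M (0 : 'rV_2) = A.
    by rewrite mul_row_col mulmx1 mulmx0 addr0.
  exact: esym E.
have := equi A (row_mx A e) u (invmx h) flag uu; rewrite unitmx_inv invmxK => /(_ uh).
rewrite -/e Eh => ->; have /colP/(_ j) := sA; rewrite mxE [RHS]mxE /= -/e rAe => ->.
by rewrite mulr0.
Qed.

End Embeddings.

Theorem mainTheorem5 (R : realType)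
    (s : 'M[R[i]]_(5, 2) -> 'M[R[i]]_(5, 3) -> R[i])
    (shat : 'M[R[i]]_(5, 3) -> 'cV[R[i]]_3)
    (hs : section_O11 s)
    (hX : calabi_yau3_zero_scheme (ppush s))
    (hY : calabi_yau3_zero_scheme (qpush s))
    (hpoly : exists p, forall B i, shat B i 0 = peval (p i) B)
    (hshat : forall B, \rank B == 3%N -> shat B = qpush s B) :
  [/\ glsm (@model_act R) (superpotential shat),
      forall tau tau' : int, tau != 0 -> tau' != 0 ->
        (same_phase (@model_act R) (rho tau) (rho tau') <->
         (0 < tau) = (0 < tau')),
      forall tau : int, 0 < tau ->
        let M := vacuum_manifold (@model_act R) (superpotential shat) (rho tau)
        in isomorphic M (zero_locus (qpush s)) /\ calabi_yau3 M &
      forall tau : int, tau < 0 ->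
        let M := vacuum_manifold (@model_act R) (superpotential shat) (rho tau)
        in isomorphic M (zero_locus (ppush s)) /\ calabi_yau3 M].
Proof.
have shat_poly j : polyfun (fun B => shat B j 0).
  by have [p Ep] := hpoly; exists (p j) => B; apply: Ep.
have [smoothX cyX] := hX; have [smoothY cyY] := hY.
have cy S Z : isomorphic (git_quotient (@model_act R) S) Z -> calabi_yau3 Z ->
    isomorphic (git_quotient (@model_act R) S) Z /\
    calabi_yau3 (git_quotient (@model_act R) S).
  move=> iso cyZ; split=> //; apply: calabi_yau3_isomorphic (isomorphic_sym iso) cyZ.
  exact: openI (quotient_sheafy _ (subspace_sheafy _ (affine_sheafy _))).
split.
- exact: glsm_model shat_poly (shat_equivariant hs shat_poly hshat).
- exact: same_phase_sign.
- move=> tau tau0; apply: cy cyY; apply: (@git_quotient_zero_locus _ _ _ _ (@pos_embedding R)).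
  + by have [p ext _] := smoothY; exists p.
  + by move=> A u rA uu sA; rewrite (qpush_equivariant hs rA uu) sA mulmx0 scaler0.
  + exact: pos_embedding_poly.
  + by move=> A; apply/eqmxP.
  + by move=> A u uu; exists u => //; rewrite act_pos_embedding.
  + move=> x; exact: stable_crit_pos.
- move=> tau tau0; apply: cy cyX; apply: (@git_quotient_zero_locus _ _ _ _ (@neg_embedding R)).
  + by have [p ext _] := smoothX; exists p.
  + by move=> A u; apply: ppush_act.
  + exact: neg_embedding_poly.
  + exact: neg_embedding_span.
  + exact: neg_embedding_act.
  + move=> x; exact: stable_crit_neg.
Qed.
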